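(* The action of $\operatorname{U}_1(\mathcal H_+)=\operatorname{O}_{1,2}(\mathcal V)\cap\operatorname{Sp}_{1,2}(\mathcal V,\Omega)$ by right multiplication preserves the level set $\mu_{\operatorname{O}}^{-1}(0)\subset\operatorname{GL}_{1,2}(\mathcal V)$, where $\mu_{\operatorname{O}}$ is the map with values in $\mathfrak o_{1,2}(\mathcal V)^*$ given by $\langle\mu_{\operatorname{O}}(M)|A\rangle=-\frac12\operatorname{Tr}\big((M^*JM-J)A\big)$ for $M\in\operatorname{GL}_{1,2}(\mathcal V)$ and $A\in\mathfrak o_{1,2}(\mathcal V)$.
   Context: $\mathcal V$ is a real infinite-dimensional separable Hilbert space with inner product $\langle\cdot,\cdot\rangle_{\mathcal V}$, and $J$ is a bounded real-linear operator on $\mathcal V$ with $J^2=-\operatorname{id}_{\mathcal V}$ and $\langle Ju,Jv\rangle_{\mathcal V}=\langle u,v\rangle_{\mathcal V}$; $\Omega(u,v)=\langle u,Jv\rangle_{\mathcal V}$. $\mathcal H=\mathcal V\otimes\mathbb C$ is the complexification with its induced Hermitian scalar product, $J$ is extended $\mathbb C$-linearly to $\mathcal H$, and $\mathcal H=\mathcal H_+\oplus\mathcal H_-$ where $\mathcal H_\pm$ is the eigenspace of $J$ for $\pm i$. Complex conjugation of $\mathcal H$ with respect to $\mathcal V$ exchanges $\mathcal H_\pm$; for a bounded operator $A$ set $\bar Au:=\overline{A\bar u}$; $A^*$ is the Hermitian adjoint. $L^1$, $L^2$ denote trace class and Hilbert-Schmidt operators; $\operatorname{Tr}$ is the trace on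 $\mathcal H$. With block matrices relative to $\mathcal H_+\oplus\mathcal H_-$, $$\mathfrak{gl}_{1,2}(\mathcal V)=\left\{\begin{pmatrix}A_1&A_2\\ \bar A_2&\bar A_1\end{pmatrix}\ \middle|\ A_1\in L^1(\mathcal H_+),\ A_2\in L^2(\mathcal H_-,\mathcal H_+)\right\},$$ with norm $\|A_1\|_1+\|A_2\|_2$, and $\operatorname{GL}_{1,2}(\mathcal V)$ is the group of invertible elements of $\mathcal M_{1,2}(\mathcal V)=\operatorname{id}_{\mathcal H}+\mathfrak{gl}_{1,2}(\mathcal V)$. $\operatorname{O}_{1,2}(\mathcal V)=\{a\in\operatorname{GL}_{1,2}(\mathcal V)\mid a^*a=\operatorname{id}_{\mathcal H}\}$ with Lie algebra $\mathfrak o_{1,2}(\mathcal V)=\{A\in\mathfrak{gl}_{1,2}(\mathcal V)\mid A^*+A=0\}$; $\operatorname{Sp}_{1,2}(\mathcal V,\Omega)=\{a\in\operatorname{GL}_{1,2}(\mathcal V)\mid a^*Ja=J\}$. $\operatorname{U}_1(\mathcal H_+)$ is the group of unitary operators $u$ on $\mathcal H_+$ with $u-\operatorname{id}_{\mathcal H_+}\in L^1(\mathcal H_+)$, identified with $\operatorname{O}_{1,2}(\mathcal V)\cap\operatorname{Sp}_{1,2}(\mathcal V,\Omega)$ via $u\mapsto\begin{pmatrix}u&0\\0&\bar u\end{pmatrix}$. *)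

(* Defs.v *)
(* MathComp, with MathComp-Analysis and mathcomp-real-closed's R[i]. *)
From HB Require Import structures.
From mathcomp Require Import all_boot all_order all_algebra.
From mathcomp Require Import complex ring.
From mathcomp Require Import all_classical all_reals all_analysis.

Set Implicit Arguments.
Unset Strict Implicit.
Unset Printing Implicit Defensive.

Import Order.TTheory GRing.Theory Num.Theory.
Import numFieldNormedType.Exports.

Local Open Scope classical_set_scope.
Local Open Scope ring_scope.
Local Open Scope complex_scope.

(* Real Hilbert spaces: Banach spaces whose norm comes from an inner product. *)
HB.mixin Record NormedModule_hasInner (R : realType) V
    of CompleteNormedModule R V := {
  inner : {dot V for (@idfun R)};
  inner_norm : forall v : V, inner v v = `|v| ^+ 2
}.

#[short(type="realHilbertType")]
HB.structure Definition RealHilbert (R : realType) :=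
  {V of NormedModule_hasInner R V & CompleteNormedModule R V}.

(* Complex inner product spaces, linear in the first argument. Completeness is
   not part of the structure; it holds for the instances used below, namely the
   complexification of a real Hilbert space and the eigenspaces of a bounded
   operator on it. *)
HB.mixin Record Lmodule_hasHerm (R : realType) E of GRing.Lmodule R[i] E := {
  herm : {dot E for (@Num.conj R[i])}
}.

#[short(type="hermType")]
HB.structure Definition Herm (R : realType) :=
  {E of Lmodule_hasHerm R E & GRing.Lmodule R[i] E}.

Section Operators.
Variable R : realType.
Implicit Types E F : hermType R.

Definition hnorm E (u : E) : R := Num.sqrt (complex.Re (herm u u)).

Definition bounded_op E F (A : E -> F) :=
  linear A /\ exists C : R, forall u, hnorm (A u) <= C * hnorm u.

(* Only meaningful in infinite-dimensional separable spaces: a Hilbert basis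
   is indexed by nat. *)
Definition hilbert_basis E (e : nat -> E) :=
  (forall m n, herm (e m) (e n) = (m == n)%:R) /\
  (forall u, (forall n, herm u (e n) = 0) -> u = 0).

(* The Hermitian adjoint. It exists and is unique for a bounded operator between
   Hilbert spaces, so the default value 0 is irrelevant. *)
Definition adj E F (A : E -> F) : F -> E :=
  xget (fun=> 0) [set B : F -> E | bounded_op B /\
                    forall u v, herm (A u) v = herm u (B v)].

Definition positive_op E (P : E -> E) :=
  bounded_op P /\ forall u, 0 <= herm (P u) u.

(* |A|, the unique positive square root of A^* A. *)
Definition abs_op E F (A : E -> F) : E -> E :=
  xget (fun=> 0) [set P : E -> E | positive_op P /\ P \o P = adj A \o A].

(* Whether the sum of squares below is finite does not depend on the Hilbert
   basis; the same remark applies to trace_class. *)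
Definition hilbert_schmidt E F (A : E -> F) :=
  bounded_op A /\ exists2 e : nat -> E, hilbert_basis e &
    cvgn (series (fun n => hnorm (A (e n)) ^+ 2)).

Definition trace_class E F (A : E -> F) :=
  bounded_op A /\ exists2 e : nat -> E, hilbert_basis e &
    cvgn (series (fun n => complex.Re (herm (abs_op A (e n)) (e n)))).

Definition csum_to (f : nat -> R[i]) (s : R[i]) :=
  series (fun n => complex.Re (f n)) @ \oo --> complex.Re s /\
  series (fun n => complex.Im (f n)) @ \oo --> complex.Im s.

(* The common value of the sums of <A e_n, e_n> over all Hilbert bases e, which
   exists when A is of trace class. *)
Definition Tr E (A : E -> E) : R[i] :=
  xget 0 [set t : R[i] | forall e : nat -> E, hilbert_basis e ->
                           csum_to (fun n => herm (A (e n)) (e n)) t].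

End Operators.

(* The pair (x, y) stands for x + i y. *)
Definition cplx (V : Type) : Type := (V * V)%type.

Section Complexification.
Variables (R : realType) (V : realHilbertType R).

HB.instance Definition _ := GRing.Zmodule.copy (cplx V) (V * V)%type.

Definition cscale (c : R[i]) (u : cplx V) : cplx V :=
  let: a +i* b := c in (a *: u.1 - b *: u.2, a *: u.2 + b *: u.1).

Fact cscaleA a b u : cscale a (cscale b u) = cscale (a * b) u.
Proof.
case: a b u => [a a'] [b b'] [x y]; congr pair => /=.
  rewrite scalerBr scalerDr !scalerA scalerBl scalerDl !opprD.
  by rewrite [X in _ + X]addrC addrACA.
rewrite scalerBr scalerDr !scalerA scalerBl scalerDl.
by rewrite [X in _ + X]addrC addrACA.
Qed.
Fact cscale1 : left_id 1 cscale.
Proof. by case=> x y; congr pair; rewrite /= scale1r scale0r ?subr0 ?addr0. Qed.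
Fact cscaleDr : right_distributive cscale +%R.
Proof.
case=> a b [x y] [x' y']; congr pair => /=.
  by rewrite !scalerDr opprD addrACA.
by rewrite !scalerDr addrACA.
Qed.
Fact cscaleDl u : {morph cscale^~ u : a b / a + b}.
Proof.
case: u => x y [a a'] [b b']; congr pair => /=.
  by rewrite !scalerDl opprD addrACA.
by rewrite !scalerDl addrACA.
Qed.

HB.instance Definition _ := GRing.Zmodule_isLmodule.Build R[i] (cplx V)
  cscaleA cscale1 cscaleDr cscaleDl.

Definition cherm (u v : cplx V) : R[i] :=
  (inner u.1 v.1 + inner u.2 v.2) +i* (inner u.2 v.1 - inner u.1 v.2).

Fact cherm_bilinear :
  bilinear_for (GRing.Scale.Law.clone _ _ *%R _)
    (GRing.Scale.Law.clone _ _ (@Num.conj R[i] \; *%R) _) cherm.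
Proof.
split=> [v | u] [a b] [x y] [x' y']; rewrite /cherm /=; apply/eqP.
  rewrite eq_complex /= !linearDl !linearNl !linearZl_LR /=.
  by apply/andP; split; apply/eqP; ring.
rewrite eq_complex /= !(linearD (inner _)) !(linearN (inner _)).
rewrite !(linearZ_LR (inner _)) /=.
by apply/andP; split; apply/eqP; ring.
Qed.
HB.instance Definition _ := bilinear_isBilinear.Build R[i] (cplx V) (cplx V)
  R[i] _ _ cherm cherm_bilinear.

Fact cherm_hermitian u v : cherm u v = (-1) ^+ false * Num.conj (cherm v u).
Proof.
have innerC (x y : V) : inner x y = inner y x.
  by rewrite [LHS]hermitian_subproof mul1r.
apply/eqP; rewrite mul1r eq_complex /=.
by rewrite !(innerC v.1) !(innerC v.2) opprB !eqxx.
Qed.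
HB.instance Definition _ := isHermitianSesquilinear.Build R[i] (cplx V)
  false (@Num.conj R[i]) cherm cherm_hermitian.

Fact cherm_gt0 u : u != 0 -> 0 < cherm u u.
Proof.
case: u => x y xy0; rewrite /cherm /= !inner_norm.
rewrite ltcE /= hermitian_subproof mul1r subrr eqxx /=.
rewrite lt_neqAle addr_ge0 ?sqr_ge0// andbT eq_sym paddr_eq0 ?sqr_ge0//.
by rewrite !sqrf_eq0 !normr_eq0; apply: contra xy0 => /andP[/eqP-> /eqP->].
Qed.
HB.instance Definition _ := isDotProduct.Build R[i] (cplx V) cherm cherm_gt0.

HB.instance Definition _ := Lmodule_hasHerm.Build R (cplx V)
  (cherm : {dot (cplx V) for _}).

Definition conjv (u : cplx V) : cplx V := (u.1, - u.2).

Definition cext (A : V -> V) (u : cplx V) : cplx V := (A u.1, A u.2).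

Variable J : {linear V -> V}.

Fact cext_is_linear : linear (cext J).
Proof.
case=> a b u v; congr pair; rewrite /= linearD.
  by rewrite linearB !linearZ_LR.
by rewrite linearD !linearZ_LR.
Qed.
HB.instance Definition _ := GRing.isLinear.Build R[i] (cplx V) (cplx V) _
  (cext J) cext_is_linear.

Definition eigenspace_pred (s : R[i]) : {pred cplx V} :=
  fun u => cext J u == s *: u.

Fact eigenspace_submod_closed s : submod_closed (eigenspace_pred s).
Proof.
split=> [|a u v]; first by rewrite unfold_in linear0 scaler0.
rewrite !unfold_in => /eqP Ju /eqP Jv.
by rewrite linearP /= Ju Jv scalerDr !scalerA mulrC.
Qed.
HB.instance Definition _ s := GRing.isSubmodClosed.Build R[i] (cplx V)
  (eigenspace_pred s) (eigenspace_submod_closed s).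

Record eigenspace_of (s : R[i]) :=
  Eigenvector {eigenval :> cplx V; _ : eigenval \in eigenspace_pred s}.

Section Eigenspace.
Variable s : R[i].

HB.instance Definition _ := [isSub of eigenspace_of s for @eigenval s].
HB.instance Definition _ := [Choice of eigenspace_of s by <:].
HB.instance Definition _ := [SubChoice_isSubLmodule of eigenspace_of s by <:].

Definition eherm (u v : eigenspace_of s) : R[i] := herm (val u) (val v).

Fact eherm_bilinear :
  bilinear_for (GRing.Scale.Law.clone _ _ *%R _)
    (GRing.Scale.Law.clone _ _ (@Num.conj R[i] \; *%R) _) eherm.
Proof.
split=> [v | u] a x y; rewrite /eherm.
  have -> : val (a *: x + y) = a *: val x + val y by [].
  exact: linearPl.
have -> : val (a *: x + y) = a *: val x + val y by [].
exact: linearP.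
Qed.
HB.instance Definition _ := bilinear_isBilinear.Build R[i] (eigenspace_of s)
  (eigenspace_of s) R[i] _ _ eherm eherm_bilinear.

Fact eherm_hermitian u v : eherm u v = (-1) ^+ false * Num.conj (eherm v u).
Proof. exact: hermitian_subproof. Qed.
HB.instance Definition _ := isHermitianSesquilinear.Build R[i]
  (eigenspace_of s) false (@Num.conj R[i]) eherm eherm_hermitian.

Fact eherm_gt0 u : u != 0 -> 0 < eherm u u.
Proof.
move=> u0; apply: neq0_dnorm_gt0; apply: contra u0 => /eqP vu0.
exact/eqP/val_inj.
Qed.
HB.instance Definition _ := isDotProduct.Build R[i] (eigenspace_of s)
  eherm eherm_gt0.

HB.instance Definition _ := Lmodule_hasHerm.Build R (eigenspace_of s)
  (eherm : {dot (eigenspace_of s) for _}).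

(* (1 - s J) / 2, which for J^2 = -1 and s = i or s = - i is the projection of H
   onto the eigenspace for s along the other one. The default value of insubd is
   then never used: see val_eigproj and eigprojD. *)
Definition eigproj (u : cplx V) : eigenspace_of s :=
  insubd 0 (2^-1 *: (u - s *: cext J u)).

Fact val_eigproj u : (forall v, J (J v) = - v) -> s ^+ 2 = -1 ->
  val (eigproj u) = 2^-1 *: (u - s *: cext J u).
Proof.
move=> J2 s2; rewrite insubdK //; apply/eqP.
have Jc2 : cext J (cext J u) = - u by congr pair; apply: J2.
rewrite [RHS]scalerA (mulrC s) -scalerA [s *: (_ - _)]scalerBr (scalerA s s).
rewrite -expr2 s2 scaleN1r opprK.
by rewrite linearZ_LR linearB linearZ_LR /= Jc2 scalerN opprK addrC.
Qed.

End Eigenspace.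

Definition Hplus := eigenspace_of 'i.
Definition Hminus := eigenspace_of (- 'i).

Fact eigprojD u : (forall v, J (J v) = - v) ->
  (val (eigproj 'i u) : cplx V) + val (eigproj (- 'i) u) = u.
Proof.
move=> J2; have i2 : 'i ^+ 2 = -1 :> R[i] by rewrite sqr_i.
rewrite !val_eigproj ?sqrrN // scaleNr opprK -scalerDr addrACA addNr addr0.
have -> : u + u = (2 : R[i]) *: u by rewrite scaler_nat.
by rewrite scalerA mulVf ?scale1r // pnatr_eq0.
Qed.

Fact conjv_eigen s t u : t = s^* -> u \in eigenspace_pred s ->
  conjv u \in eigenspace_pred t.
Proof.
case: s => a b -> /eqP[J1 J2]; apply/eqP; congr pair => /=.
  by rewrite J1 scaleNr scalerN opprK.
by rewrite linearN J2 scaleNr scalerN opprD.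
Qed.

Fact conj_i : - 'i = 'i^* :> R[i].
Proof. by apply/eqP; rewrite eq_complex /= oppr0 !eqxx. Qed.
Fact conj_Ni : 'i = (- 'i)^* :> R[i].
Proof. by apply/eqP; rewrite eq_complex /= oppr0 opprK !eqxx. Qed.

Definition conj_pm (u : Hplus) : Hminus :=
  Eigenvector (conjv_eigen conj_i (valP u)).
Definition conj_mp (u : Hminus) : Hplus :=
  Eigenvector (conjv_eigen conj_Ni (valP u)).

(* The operator on H with block matrix ((A11, A12), (A21, A22)) relative to
   H = H_+ (+) H_-. *)
Definition block_op (A11 : Hplus -> Hplus) (A12 : Hminus -> Hplus)
    (A21 : Hplus -> Hminus) (A22 : Hminus -> Hminus) (u : cplx V) : cplx V :=
  let up : Hplus := eigproj 'i u in let um : Hminus := eigproj (- 'i) u in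
  (val (A11 up + A12 um) : cplx V) + val (A21 up + A22 um).

(* For A : H_- -> H_+, the operator conj_pm \o A \o conj_pm : H_+ -> H_- is
   the conjugate of A, and similarly for the diagonal block. *)
Definition gl12 : set (cplx V -> cplx V) :=
  [set A | exists (A1 : Hplus -> Hplus) (A2 : Hminus -> Hplus),
    [/\ trace_class A1, hilbert_schmidt A2 &
        A = block_op A1 A2 (conj_pm \o A2 \o conj_pm)
                           (conj_pm \o A1 \o conj_mp)]].

Definition M12 : set (cplx V -> cplx V) := [set idfun \+ A | A in gl12].

(* Inverses are taken inside the monoid M12. *)
Definition GL12 : set (cplx V -> cplx V) :=
  [set a | M12 a /\ exists b, [/\ M12 b, a \o b = idfun & b \o a = idfun]].

Definition O12 : set (cplx V -> cplx V) :=
  [set a | GL12 a /\ adj a \o a = idfun].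

Definition o12 : set (cplx V -> cplx V) :=
  [set A | gl12 A /\ adj A \+ A = 0].

Definition Sp12 : set (cplx V -> cplx V) :=
  [set a | GL12 a /\ adj a \o cext J \o a = cext J].

Definition U1 : set (Hplus -> Hplus) :=
  [set u | [/\ bounded_op u, adj u \o u = idfun, u \o adj u = idfun &
               trace_class (u \- idfun)]].

Definition U1_embed (u : Hplus -> Hplus) : cplx V -> cplx V :=
  block_op u (fun=> 0) (fun=> 0) (conj_pm \o u \o conj_mp).

(* The pairing <mu_O(M) | A>, for M in GL12 and A in o12. The operator under the
   trace is then of trace class on H, and the value is a real number because
   this operator commutes with complex conjugation. *)
Definition mu_O (M A : cplx V -> cplx V) : R[i] :=
  - 2^-1 * Tr ((adj M \o cext J \o M \- cext J) \o A).

(* The zero level set: the functional mu_O(M) vanishes on o12. *)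
Definition mu_O_zero : set (cplx V -> cplx V) :=
  [set M | GL12 M /\ forall A, o12 A -> mu_O M A = 0].

End Complexification.

Arguments U1 {R V} J _.
Arguments U1_embed {R V} J u _.

(* Main.v *)
Require Import Defs.
From mathcomp Require Import all_boot all_order all_algebra.
From mathcomp Require Import complex ring lra.
From mathcomp Require Import all_classical all_reals all_analysis.

Set Implicit Arguments.
Unset Strict Implicit.
Unset Printing Implicit Defensive.

Import Order.TTheory GRing.Theory Num.Theory.
Import numFieldNormedType.Exports.

Local Open Scope classical_set_scope.
Local Open Scope ring_scope.
Local Open Scope complex_scope.

(** An operator [a] that is both orthogonal and symplectic satisfies
    [a^-1 J a = J], so it commutes with [J] and is block diagonal; this gives the
    intersection. For the level set, [mu_O (M U) A = mu_O M (U A U^-1)] by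
    unitary invariance of the trace, and [U A U^-1] is again in [o12].

    What remains is that [GL12] is stable under [U], i.e. that [A1 u + (u - 1)] is
    of trace class when [A1] and [u - 1] are. Since [trace_class] is defined by
    [|A|] in one basis, additivity is obtained from a basis-free description: [A]
    is of trace class iff the sums of [Re <A x_i, y_i>] over pairs of finite
    Bessel systems are bounded. This uses the existence of positive square roots
    and a polar decomposition on finitely many vectors. *)

(** Sums are the obstacle: |A + B| is not controlled by |A| + |B|, and the two summands come with
    different bases. The test systems are Bessel rather than orthonormal because the contractions of
    the polar decomposition preserve Bessel's inequality but not orthonormality.

    Completeness is not part of [hermType]. It travels as the hypothesis [hcomplete] and is
    established only for H_+, the space on which trace-class operators are added. On H itself no
    existence theorem for adjoints or traces is used: [adj] and [Tr] select a candidate by [xget],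
    and a unitary carries the candidates of one side to those of the other, so the identities also
    hold where the default value is selected.

    Stability of [GL12] concerns the inverse as well. The inverse of M U is U^-1 M^-1, so U^-1 - 1
    must be of trace class too. *)

Section RealInnerProduct.
Variables (R : realType) (E : hermType R).
Implicit Types (u v w : E) (r : R).

(** Estimates are made with the real scalar product, which keeps them within real arithmetic.
    [herm_ReIm] recovers the Hermitian form from it. *)
Definition rdot u v : R := complex.Re (herm u v).

Lemma herm_conj u v : herm u v = (herm v u)^*.
Proof. by rewrite [LHS]hermitian_subproof mul1r. Qed.

Lemma hermDl u v w : herm (u + v) w = herm u w + herm v w.
Proof. exact: linearDl. Qed.
Lemma hermDr u v w : herm u (v + w) = herm u v + herm u w.
Proof. exact: linearDr. Qed.
Lemma hermZl c u v : herm (c *: u) v = c * herm u v.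
Proof. by rewrite linearZl_LR. Qed.
Lemma hermZr c u v : herm u (c *: v) = c^* * herm u v.
Proof. by rewrite herm_conj hermZl rmorphM [herm u v]herm_conj. Qed.

Lemma rdotC u v : rdot u v = rdot v u.
Proof. by rewrite /rdot herm_conj; case: (herm v u). Qed.
Lemma rdotDl u v w : rdot (u + v) w = rdot u w + rdot v w.
Proof. by rewrite /rdot hermDl; case: (herm u w) => ? ?; case: (herm v w). Qed.
Lemma rdotDr u v w : rdot u (v + w) = rdot u v + rdot u w.
Proof. by rewrite rdotC rdotDl !(rdotC u). Qed.
Lemma rdotZl r u v : rdot (r%:C *: u) v = r * rdot u v.
Proof. by rewrite /rdot hermZl; case: (herm u v) => ? ? /=; rewrite mul0r subr0. Qed.
Lemma rdotZr r u v : rdot u (r%:C *: v) = r * rdot u v.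
Proof. by rewrite rdotC rdotZl rdotC. Qed.
Lemma rdotNl u v : rdot (- u) v = - rdot u v.
Proof.
have -> : - u = (-1)%:C *: u by rewrite rmorphN1 scaleN1r.
by rewrite rdotZl mulN1r.
Qed.
Lemma rdotNr u v : rdot u (- v) = - rdot u v.
Proof. by rewrite rdotC rdotNl rdotC. Qed.
Lemma rdotBl u v w : rdot (u - v) w = rdot u w - rdot v w.
Proof. by rewrite rdotDl rdotNl. Qed.
Lemma rdotBr u v w : rdot u (v - w) = rdot u v - rdot u w.
Proof. by rewrite rdotDr rdotNr. Qed.
Lemma rdot0l u : rdot 0 u = 0.
Proof. by rewrite -(subrr 0) rdotBl subrr. Qed.
Lemma rdot0r u : rdot u 0 = 0.
Proof. by rewrite rdotC rdot0l. Qed.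

Lemma rdot_suml I (s : seq I) (F : I -> E) v :
  rdot (\sum_(i <- s) F i) v = \sum_(i <- s) rdot (F i) v.
Proof.
by elim: s => [|a s IH]; rewrite ?big_nil ?rdot0l// !big_cons rdotDl IH.
Qed.
Lemma rdot_sumr I (s : seq I) (F : I -> E) v :
  rdot v (\sum_(i <- s) F i) = \sum_(i <- s) rdot v (F i).
Proof. by rewrite rdotC rdot_suml; apply: eq_bigr => i _; rewrite rdotC. Qed.

Lemma herm_ReIm u v : herm u v = rdot u v +i* rdot u ('i *: v).
Proof.
rewrite /rdot hermZr; case: (herm u v) => a b /=.
by congr (_ +i* _); ring.
Qed.
Lemma rdot_iM u v : rdot ('i *: u) ('i *: v) = rdot u v.
Proof.
by rewrite /rdot hermZl hermZr; case: (herm u v) => a b /=; ring.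
Qed.
Lemma rdot_il u v : rdot ('i *: u) v = - rdot u ('i *: v).
Proof. by rewrite /rdot hermZl hermZr; case: (herm u v) => a b /=; ring. Qed.

Lemma rdot_ge0 u : 0 <= rdot u u.
Proof.
have [->|u0] := eqVneq u 0; first by rewrite rdot0l.
have : 0 < herm u u by exact: neq0_dnorm_gt0.
by rewrite ltcE => /andP[_ /ltW].
Qed.
Lemma rdot_eq0 u : rdot u u = 0 -> u = 0.
Proof.
move=> uu0; apply/eqP; apply: contra_eqT uu0 => u0.
have : 0 < herm u u by exact: neq0_dnorm_gt0.
rewrite ltcE => /andP[_]; rewrite -[complex.Re (herm u u)]/(rdot u u).
by rewrite lt0r => /andP[].
Qed.

Lemma hnorm_sqr u : hnorm u ^+ 2 = rdot u u.
Proof. by rewrite sqr_sqrtr// rdot_ge0. Qed.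
Lemma hnorm_ge0 u : 0 <= hnorm u.
Proof. exact: sqrtr_ge0. Qed.
Lemma hnorm0 : hnorm (0 : E) = 0.
Proof. by rewrite /hnorm -/(rdot 0 0) rdot0l sqrtr0. Qed.
Lemma hnorm_eq0 u : hnorm u = 0 -> u = 0.
Proof. by move=> u0; apply: rdot_eq0; rewrite -hnorm_sqr u0 expr0n. Qed.
Lemma hnormN u : hnorm (- u) = hnorm u.
Proof. by rewrite /hnorm -!/(rdot _ _) rdotNl rdotNr opprK. Qed.
Lemma hnormB u v : hnorm (u - v) = hnorm (v - u).
Proof. by rewrite -hnormN opprB. Qed.
Lemma hnormZ r u : hnorm (r%:C *: u) = `|r| * hnorm u.
Proof.
by rewrite /hnorm -!/(rdot _ _) rdotZl rdotZr mulrA -expr2 sqrtrM ?sqr_ge0// sqrtr_sqr.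
Qed.
Lemma hnorm_le u a : 0 <= a -> rdot u u <= a ^+ 2 -> hnorm u <= a.
Proof. by move=> a0 ua; rewrite -(ler_pXn2r (n := 2)) ?nnegrE ?hnorm_ge0// hnorm_sqr. Qed.

(** Stated for a semidefinite form because it is applied to [rdot (T u) v] with [T] positive as well
    as to [rdot]; the case [q v v = 0] is therefore separate. *)
Lemma form_cauchy_schwarz (q : E -> E -> R) :
    (forall u v, q u v = q v u) -> (forall u v w, q (u + v) w = q u w + q v w) ->
    (forall r u v, q (r%:C *: u) v = r * q u v) -> (forall u, 0 <= q u u) ->
  forall u v, q u v ^+ 2 <= q u u * q v v.
Proof.
move=> qC qD qZ q0 u v.
have expand (t : R) : q (u + t%:C *: v) (u + t%:C *: v) =
    q u u + 2 * t * q u v + t ^+ 2 * q v v.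
  by rewrite qD qZ ![q _ (u + _)]qC !qD !qZ (qC v u); ring.
have [v0|v0] := eqVneq (q v v) 0.
  have [->|uv0] := eqVneq (q u v) 0; first by rewrite expr0n mulr_ge0.
  (* With this coefficient the form takes the value -1. *)
  have := q0 (u + (- (q u u + 1) / (2 * q u v))%:C *: v).
  rewrite expand v0 mulr0 addr0.
  have -> : 2 * (- (q u u + 1) / (2 * q u v)) * q u v = - (q u u + 1) by field.
  by rewrite opprD addrA subrr add0r oppr_ge0 ler10.
have := q0 (u + (- q u v / q v v)%:C *: v); rewrite expand.
have -> : q u u + 2 * (- q u v / q v v) * q u v + (- q u v / q v v) ^+ 2 * q v v =
  (q u u * q v v - q u v ^+ 2) / q v v by field.
by rewrite pmulr_lge0 ?subr_ge0// invr_gt0 lt0r v0 q0.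
Qed.

Lemma cauchy_schwarz u v : `|rdot u v| <= hnorm u * hnorm v.
Proof.
rewrite -(ler_pXn2r (n := 2)) ?nnegrE ?mulr_ge0 ?hnorm_ge0//.
rewrite real_normK ?num_real// exprMn !hnorm_sqr.
by apply: (form_cauchy_schwarz (q := rdot)); [exact: rdotC|exact: rdotDl|
  exact: rdotZl|exact: rdot_ge0].
Qed.
Lemma rdot_le u v : rdot u v <= hnorm u * hnorm v.
Proof. exact: le_trans (ler_norm _) (cauchy_schwarz _ _). Qed.

Lemma hnormD u v : hnorm (u + v) <= hnorm u + hnorm v.
Proof.
apply: hnorm_le; first by rewrite addr_ge0 ?hnorm_ge0.
rewrite rdotDl !rdotDr (rdotC v u) sqrrD !hnorm_sqr.
have := rdot_le u v; lra.
Qed.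
Lemma hnormBD u v w : hnorm (u - w) <= hnorm (u - v) + hnorm (v - w).
Proof. by have := hnormD (u - v) (v - w); rewrite addrA subrK. Qed.

(** Testing against [w] turns an identity between vectors into a linear one between reals, which
    [lra] settles; the square root construction relies on this. *)
Lemma rdot_ext u v : (forall w, rdot u w = rdot v w) -> u = v.
Proof.
by move=> uv; apply/eqP; rewrite -subr_eq0; apply/eqP/rdot_eq0; rewrite rdotBl uv subrr.
Qed.
End RealInnerProduct.

(** * Bounded linear operators *)

Section BoundedOperators.
Variable R : realType.
Implicit Types E F G : hermType R.


Lemma opD E F (A : E -> F) : linear A -> {morph A : u v / u + v}.
Proof. by move=> linA u v; have := linA 1 u v; rewrite !scale1r. Qed.
Lemma op0 E F (A : E -> F) : linear A -> A 0 = 0.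
Proof.
move=> /opD AD; have := AD 0 0; rewrite addr0 => /esym/eqP.
by rewrite -subr_eq0 addrK => /eqP.
Qed.
Lemma opZ E F (A : E -> F) : linear A -> forall c u, A (c *: u) = c *: A u.
Proof. by move=> linA c u; have := linA c u 0; rewrite (op0 linA) !addr0. Qed.
Lemma opN E F (A : E -> F) : linear A -> {morph A : u / - u}.
Proof. by move=> /opZ AZ u; rewrite -scaleN1r AZ scaleN1r. Qed.
Lemma opB E F (A : E -> F) : linear A -> {morph A : u v / u - v}.
Proof. by move=> linA u v; rewrite opD// opN. Qed.
Lemma op_sum E F (A : E -> F) : linear A -> forall I (s : seq I) f,
  A (\sum_(i <- s) f i) = \sum_(i <- s) A (f i).
Proof.
by move=> linA I s f; elim: s => [|i s IH]; rewrite ?big_nil ?op0// !big_cons opD// IH.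
Qed.

Lemma bop_pos E F (A : E -> F) : bounded_op A ->
  exists2 C : R, 0 < C & forall u, hnorm (A u) <= C * hnorm u.
Proof.
case=> _ [C AC]; exists (`|C| + 1); first by rewrite ltr_wpDl.
move=> u; apply: le_trans (AC u) _; apply: ler_wpM2r; first exact: hnorm_ge0.
by have := ler_norm C; lra.
Qed.

Lemma bounded_opD E F (A B : E -> F) :
  bounded_op A -> bounded_op B -> bounded_op (A \+ B).
Proof.
move=> [linA [C AC]] [linB [D BD]]; split.
  by move=> a u v /=; rewrite linA linB scalerDr addrACA.
exists (C + D) => u /=; apply: le_trans (hnormD _ _) _.
by rewrite mulrDl lerD.
Qed.
Lemma bounded_op_comp E F G (A : F -> G) (B : E -> F) :
  bounded_op A -> bounded_op B -> bounded_op (A \o B).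
Proof.
move=> bA [linB [D BD]]; have [linA _] := bA; have [C C0 AC] := bop_pos bA; split.
  by move=> a u v /=; rewrite linB linA.
exists (C * D) => u /=; apply: le_trans (AC _) _.
by rewrite -mulrA ler_wpM2l// ltW.
Qed.
Lemma bounded_op_id E : bounded_op (@idfun E).
Proof. by split=> //; exists 1 => u; rewrite mul1r. Qed.
Lemma bounded_op0 E F : bounded_op ((fun=> 0) : E -> F).
Proof.
split; first by move=> a u v; rewrite scaler0 addr0.
by exists 0 => u; rewrite hnorm0 mul0r.
Qed.
Lemma bounded_opN E F (A : E -> F) : bounded_op A -> bounded_op (fun u => - A u).
Proof.
move=> [linA [C AC]]; split; last by exists C => u; rewrite hnormN.
by move=> a u v; rewrite linA opprD scalerN.
Qed.
End BoundedOperators.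

(** * Hilbert bases, the Riesz-Fischer theorem and adjoints *)

Section HilbertSpace.
Variable R : realType.
Implicit Types E F : hermType R.

Definition hcvg E (x : nat -> E) (l : E) :=
  forall e : R, 0 < e -> exists N, forall n, (N <= n)%N -> hnorm (x n - l) <= e.

Definition hcauchy E (x : nat -> E) :=
  forall e : R, 0 < e -> exists N, forall m n, (N <= n)%N -> (n <= m)%N ->
    hnorm (x m - x n) <= e.

Definition hcomplete E := forall x : nat -> E, hcauchy x -> exists l, hcvg x l.

Lemma nondecreasing_bounded_cauchy (s : nat -> R) (C : R) :
    {homo s : m n / (m <= n)%N >-> m <= n} -> (forall n, s n <= C) ->
  forall e : R, 0 < e -> exists N, forall m n, (N <= n)%N -> (n <= m)%N ->
    s m - s n <= e.
Proof.
move=> s_nd sC e e0.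
have : cvgn s by apply: nondecreasing_is_cvgn => //; exists C => _ [n _ <-].
move=> s_cvg; have s_le := nondecreasing_cvgn_le s_nd s_cvg.
move/cvgrPdist_le : s_cvg => /(_ _ e0)[N _ sN]; exists N => m n Nn nm.
have := sN n Nn; have := s_le m; have := ler_norm (limn s - s n).
by rewrite /=; lra.
Qed.

Lemma nneg_series_cvg (f : nat -> R) (C : R) :
  (forall n, 0 <= f n) -> (forall n, \sum_(i < n) f i <= C) -> cvgn (series f).
Proof.
move=> f0 fC; apply: nondecreasing_is_cvgn.
  by apply: nondecreasing_series => n _ _; exact: f0.
by exists C => _ [n _ <-]; rewrite /series /= big_mkord.
Qed.

Lemma nneg_series_bounded (f : nat -> R) :
  (forall n, 0 <= f n) -> cvgn (series f) ->
  exists C, forall n, \sum_(i < n) f i <= C.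
Proof.
move=> f0 f_cvg; exists (limn (series f)) => n.
have f_nd : {homo series f : m n / (m <= n)%N >-> m <= n}.
  by apply: nondecreasing_series => k _ _; exact: f0.
by have := nondecreasing_cvgn_le f_nd f_cvg n; rewrite /series /= big_mkord.
Qed.

Lemma hcvg_rdot E (x : nat -> E) l v c :
  hcvg x l -> (forall n, rdot (x n) v <= c) -> rdot l v <= c.
Proof.
move=> xl xc; apply/ler_addgt0Pr => e e0.
have v0 : 0 < hnorm v + 1 by rewrite ltr_wpDl// hnorm_ge0.
have [N xN] := xl _ (divr_gt0 e0 v0).
have -> : l = x N - (x N - l) by rewrite opprB addrC subrK.
rewrite rdotBl lerD//.
have := cauchy_schwarz (x N - l) v; rewrite ler_norml => /andP[+ _].
rewrite lerNl => /le_trans; apply.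
apply: le_trans (ler_wpM2r (hnorm_ge0 _) (xN _ (leqnn N))) _.
by rewrite mulrAC ler_pdivrMr// ler_pM2l// lerDl.
Qed.

Lemma hcvg_rdot_eq E (x : nat -> E) l v c N :
  hcvg x l -> (forall n, (N <= n)%N -> rdot (x n) v = c) -> rdot l v = c.
Proof.
move=> xl xc; have xl' : hcvg (fun n => x (n + N)%N) l.
  by move=> e /xl[M xM]; exists M => n Mn; apply: xM; rewrite (leq_trans Mn)// leq_addr.
apply/eqP; rewrite eq_le; apply/andP; split.
  by apply: hcvg_rdot xl' _ => n; rewrite xc// leq_addl.
rewrite -lerN2 -rdotNr; apply: hcvg_rdot xl' _ => n.
by rewrite rdotNr xc// leq_addl.
Qed.

Lemma hcvg_op E F (A : E -> F) x l : bounded_op A -> hcvg x l -> hcvg (A \o x) (A l).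
Proof.
move=> bA xl e e0; have [C C0 AC] := bop_pos bA.
have [N xN] := xl _ (divr_gt0 e0 C0); exists N => n /xN; rewrite ler_pdivlMr// => Cx.
have [linA _] := bA; rewrite /= -(opB linA); apply: le_trans (AC _) _.
by rewrite mulrC.
Qed.

Definition sqn (z : R[i]) : R := complex.Re z ^+ 2 + complex.Im z ^+ 2.

Lemma sqn_ge0 z : 0 <= sqn z.
Proof. by rewrite addr_ge0 ?sqr_ge0. Qed.

Lemma sqn_herm E (u v : E) : sqn (herm u v) = rdot u v ^+ 2 + rdot u ('i *: v) ^+ 2.
Proof. by rewrite herm_ReIm. Qed.

Section Orthonormal.
Variables (E : hermType R) (e : nat -> E).
Hypothesis eON : forall m n, herm (e m) (e n) = (m == n)%:R.
Implicit Types (r : seq nat) (z : nat -> R[i]) (u v : E).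

Definition combination z N : E := \sum_(k <- iota 0 N) z k *: e k.

Lemma herm_sum r z v : herm (\sum_(k <- r) z k *: e k) v = \sum_(k <- r) z k * herm (e k) v.
Proof.
elim: r => [|a r IH]; last by rewrite !big_cons hermDl hermZl IH.
by rewrite !big_nil -[0 in LHS](scale0r (0 : E)) hermZl mul0r.
Qed.

Lemma herm_combination r z j : uniq r ->
  herm (\sum_(k <- r) z k *: e k) (e j) = if j \in r then z j else 0.
Proof.
move=> ur; rewrite herm_sum; case: ifPn => jr.
  rewrite (bigD1_seq j)//= eON eqxx mulr1 big1 ?addr0// => k kj.
  by rewrite eON (negbTE kj) mulr0.
rewrite big_seq big1// => k kr; rewrite eON; case: eqVneq => [kj|]; last by rewrite mulr0.
by rewrite -kj kr in jr.
Qed.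

Lemma rdot_combination r z : uniq r ->
  rdot (\sum_(k <- r) z k *: e k) (\sum_(k <- r) z k *: e k) = \sum_(k <- r) sqn (z k).
Proof.
move=> ur; rewrite rdot_sumr [LHS]big_seq [RHS]big_seq; apply: eq_bigr => j jr.
rewrite /rdot hermZr herm_combination// jr; case: (z j) => a b.
by rewrite /sqn /=; ring.
Qed.

Lemma combinationB z n m : (n <= m)%N ->
  combination z m - combination z n = \sum_(k <- iota n (m - n)) z k *: e k.
Proof.
by move=> nm; rewrite /combination -{1}(subnKC nm) iotaD big_cat /= add0n addrAC subrr add0r.
Qed.

(** By Pythagoras, the squared distance of two partial sums is a difference of two terms of a
    bounded nondecreasing real sequence. *)
Lemma riesz_fischer z C : hcomplete E -> (forall N, \sum_(k <- iota 0 N) sqn (z k) <= C) ->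
  exists l, hcvg (combination z) l.
Proof.
move=> cE zC; apply: cE => eps eps0.
pose s N := \sum_(k <- iota 0 N) sqn (z k).
have s_diff m n : (n <= m)%N -> s m - s n = \sum_(k <- iota n (m - n)) sqn (z k).
  by move=> nm; rewrite /s -{1}(subnKC nm) iotaD big_cat /= add0n addrAC subrr add0r.
have s_nd : {homo s : m n / (m <= n)%N >-> m <= n}.
  by move=> m n mn; rewrite -subr_ge0 s_diff// sumr_ge0// => k _; exact: sqn_ge0.
have [N sN] := nondecreasing_bounded_cauchy s_nd zC (exprn_gt0 2 eps0).
exists N => m n Nn nm; apply: hnorm_le; first exact: ltW.
by rewrite combinationB// rdot_combination ?iota_uniq// -s_diff// sN.
Qed.

Lemma hcvg_coef z l j : hcvg (combination z) l -> herm l (e j) = z j.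
Proof.
move=> zl; have coefN n : (j < n)%N -> herm (combination z n) (e j) = z j.
  by move=> jn; rewrite herm_combination ?iota_uniq// mem_iota jn.
rewrite herm_ReIm (hcvg_rdot_eq (c := complex.Re (z j)) (N := j.+1) zl); last first.
  by move=> n /coefN; rewrite /rdot => ->.
rewrite (hcvg_rdot_eq (c := complex.Im (z j)) (N := j.+1) zl); first by case: (z j).
by move=> n /coefN; rewrite herm_ReIm => <-.
Qed.

Definition hproj u N := combination (fun k => herm u (e k)) N.

Lemma rdot_hproj u N : rdot u (hproj u N) = \sum_(k <- iota 0 N) sqn (herm u (e k)).
Proof.
rewrite /hproj rdot_sumr; apply: eq_bigr => k _.
by rewrite /rdot hermZr /sqn; case: (herm u (e k)) => a b /=; ring.
Qed.

Lemma bessel_defect u N :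
  hnorm (u - hproj u N) ^+ 2 = rdot u u - \sum_(k <- iota 0 N) sqn (herm u (e k)).
Proof.
rewrite hnorm_sqr rdotBl !rdotBr rdot_combination ?iota_uniq// [rdot _ u in X in _ - X]rdotC.
by rewrite rdot_hproj; ring.
Qed.

Lemma bessel_ineq u N : \sum_(k <- iota 0 N) sqn (herm u (e k)) <= rdot u u.
Proof. by rewrite -subr_ge0 -bessel_defect sqr_ge0. Qed.

End Orthonormal.

(** Bessel's inequality and Riesz-Fischer give some limit. Its difference with [u] has zero
    coefficients, so totality of the basis identifies the two. *)
Lemma hproj_cvg E (e : nat -> E) u : hcomplete E -> hilbert_basis e -> hcvg (hproj e u) u.
Proof.
move=> cE [eON e_tot].
have [l ul] := riesz_fischer eON cE (bessel_ineq eON u).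
suff lu : l = u by rewrite -{2}lu.
apply/eqP; rewrite -subr_eq0; apply/eqP/e_tot => n.
by rewrite hermDl -scaleN1r hermZl (hcvg_coef eON _ ul) mulN1r subrr.
Qed.

(** A finite family admits one truncation index for all its vectors, so in applications only finite
    sums are exchanged. *)
Lemma parseval_le E (e : nat -> E) (s : seq E) C : hcomplete E -> hilbert_basis e ->
  (forall N, \sum_(v <- s) \sum_(k <- iota 0 N) sqn (herm v (e k)) <= C) ->
  \sum_(v <- s) rdot v v <= C.
Proof.
move=> cE eB sC; have [eON _] := eB.
suff H eps : 0 < eps -> exists N0, forall N, (N0 <= N)%N -> \sum_(v <- s) rdot v v <=
    \sum_(v <- s) \sum_(k <- iota 0 N) sqn (herm v (e k)) + eps.
  by apply/ler_addgt0Pr => eps /H[N /(_ _ (leqnn N)) HN]; apply: le_trans HN _; rewrite lerD2r.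
elim: s {sC} eps => [|v s IH] eps eps0; first by exists 0%N => N _; rewrite !big_nil add0r ltW.
have [N1 sN1] := IH _ (divr_gt0 eps0 (ltr0Sn _ 1)).
have eps2 : 0 < Num.sqrt (eps / 2) by rewrite sqrtr_gt0; lra.
have [N2 vN2] := hproj_cvg v cE eB eps2.
exists (maxn N1 N2) => N; rewrite geq_max => /andP[N1N N2N].
rewrite !big_cons; have := sN1 _ N1N; suff : rdot v v <=
  \sum_(k <- iota 0 N) sqn (herm v (e k)) + eps / 2 by lra.
rewrite -lerBlDl -bessel_defect// -(sqr_sqrtr (a := eps / 2)); last by lra.
by rewrite ler_pXn2r ?nnegrE ?hnorm_ge0 ?sqrtr_ge0// hnormB vN2.
Qed.

Definition is_adjoint E F (A : E -> F) (B : F -> E) :=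
  bounded_op B /\ forall u v, herm (A u) v = herm u (B v).

Lemma is_adjoint_unique E F (A : E -> F) B B' :
  (forall u v, herm (A u) v = herm u (B v)) -> (forall u v, herm (A u) v = herm u (B' v)) -> B = B'.
Proof.
move=> AB AB'; apply/funext => v; apply: rdot_ext => u.
by rewrite !(rdotC _ u) /rdot -AB -AB'.
Qed.

Lemma adj_eq E F (A : E -> F) B : is_adjoint A B -> adj A = B.
Proof.
move=> AB; have : is_adjoint A (adj A) by apply: xgetPex; exists B.
by move=> [_ AA]; apply: is_adjoint_unique AA _; case: AB.
Qed.

(** The imaginary part is the real identity at ['i *: u], which is where complex linearity of [A]
    enters. *)
Lemma rdot_herm E F (A : E -> F) B : linear A ->
  (forall u v, rdot (A u) v = rdot u (B v)) -> forall u v, herm (A u) v = herm u (B v).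
Proof.
move=> linA AB u v; rewrite !herm_ReIm AB; congr (_ +i* _).
by rewrite -[LHS]opprK -rdot_il -opZ// AB rdot_il opprK.
Qed.

Lemma adjoint_exists E F (e : nat -> E) (A : E -> F) :
  hcomplete E -> hilbert_basis e -> bounded_op A -> exists B, is_adjoint A B.
Proof.
move=> cE eB bA; have [eON _] := eB; have [linA _] := bA; have [C C0 AC] := bop_pos bA.
have riesz v : exists y, forall u, rdot (A u) v = rdot u y.
  (* The coefficients, in the basis [e], of the vector representing the functional u |-> <A u,
     v>. *)
  pose z k := (herm (A (e k)) v)^*.
  have Ayz N : rdot (A (combination e z N)) v = \sum_(k <- iota 0 N) sqn (z k).
    rewrite op_sum// rdot_suml; apply: eq_bigr => k _.
    by rewrite opZ// /rdot hermZl /z /sqn; case: (herm _ v) => a b /=; ring.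
  have zb N : \sum_(k <- iota 0 N) sqn (z k) <= (C * hnorm v) ^+ 2.
    set S := \sum_(k <- _) _.
    have S0 : 0 <= S by rewrite sumr_ge0// => k _; exact: sqn_ge0.
    have yS : hnorm (combination e z N) ^+ 2 = S by rewrite hnorm_sqr rdot_combination// iota_uniq.
    (* The functional is evaluated at its own partial sum y_N: S = |y_N|^2 is at most C |y_N| |v|,
       and dividing by |y_N| gives a bound independent of N. *)
    have yC : S <= C * hnorm (combination e z N) * hnorm v.
      rewrite -{1}/S /S -Ayz; apply: le_trans (rdot_le _ _) _.
      by rewrite ler_wpM2r ?hnorm_ge0// AC.
    have [y0|y0] := eqVneq (hnorm (combination e z N)) 0.
      by rewrite -yS y0 expr0n sqr_ge0.
    rewrite -yS ler_pXn2r ?nnegrE ?mulr_ge0 ?hnorm_ge0//; last exact: ltW.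
    have y1 : 0 < hnorm (combination e z N) by rewrite lt0r y0 hnorm_ge0.
    by rewrite -(ler_pM2r y1) -expr2 yS mulrAC.
  have [y zy] := riesz_fischer eON cE zb; exists y => u.
  have uN N : rdot (A (hproj e u N)) v = rdot (hproj e u N) y.
    rewrite /hproj op_sum// !rdot_suml; apply: eq_bigr => k _.
    by rewrite opZ// /rdot !hermZl [herm (e k) y]herm_conj (hcvg_coef eON _ zy) conjcK.
  have uu := hproj_cvg u cE eB.
  have Auu := hcvg_op bA uu.
  apply/eqP; rewrite -subr_eq0 -normr_le0; apply/ler_addgt0Pr => eps eps0.
  pose K := C * hnorm v + hnorm y + 1.
  have K0 : 0 < K by rewrite ltr_wpDl// addr_ge0 ?mulr_ge0 ?hnorm_ge0// ltW.
  have [N uN'] := hproj_cvg u cE eB (divr_gt0 eps0 K0).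
  have := uN' N (leqnn N); rewrite ler_pdivlMr// add0r hnormB; apply: le_trans.
  have -> : rdot (A u) v - rdot u y =
      rdot (A (u - hproj e u N)) v - rdot (u - hproj e u N) y.
    by rewrite opB// !rdotBl uN; ring.
  have := cauchy_schwarz (A (u - hproj e u N)) v.
  have := cauchy_schwarz (u - hproj e u N) y.
  have := ler_wpM2r (hnorm_ge0 v) (AC (u - hproj e u N)).
  have := ler_normB (rdot (A (u - hproj e u N)) v) (rdot (u - hproj e u N) y).
  have := hnorm_ge0 (u - hproj e u N).
  by rewrite /K; lra.
have [B AB'] := choice riesz.
have AB u v : rdot (A u) v = rdot u (B v) by exact: AB'.
have hAB := rdot_herm linA AB.
have linB : linear B.
  move=> a v w; apply: rdot_ext => u; rewrite !(rdotC _ u) /rdot; congr complex.Re.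
  by rewrite -hAB !hermDr !hermZr !hAB.
exists B; split=> //.
split=> //; exists C => v.
have [->|Bv0] := eqVneq (hnorm (B v)) 0; first by rewrite mulr_ge0 ?hnorm_ge0// ltW.
have Bv1 : 0 < hnorm (B v) by rewrite lt0r Bv0 hnorm_ge0.
rewrite -(ler_pM2r Bv1) -expr2 hnorm_sqr -AB; apply: le_trans (rdot_le _ _) _.
by rewrite mulrAC ler_wpM2r ?hnorm_ge0.
Qed.

Lemma adjP E F (e : nat -> E) (A : E -> F) :
  hcomplete E -> hilbert_basis e -> bounded_op A -> is_adjoint A (adj A).
Proof. by move=> cE eB /(adjoint_exists cE eB) AB; exact: xgetPex. Qed.

End HilbertSpace.

(** * Square roots of positive operators *)

Section PositiveSquareRoot.
Variable R : realType.
Implicit Types E F : hermType R.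

Lemma hnorm_scale E (c : R[i]) (u : E) : hnorm (c *: u) = Num.sqrt (sqn c) * hnorm u.
Proof.
rewrite /hnorm -sqrtrM ?sqn_ge0//; congr Num.sqrt; rewrite hermZl hermZr herm_ReIm.
have -> : rdot u ('i *: u) = 0.
  by apply/eqP; rewrite -[_ == 0](mulrn_eq0 _ 2) mulr2n {1}rdotC rdot_il addNr.
by rewrite /sqn; case: c => a b /=; ring.
Qed.

Lemma hnorm_small E (u : E) (K : R) : (forall e : R, 0 < e -> hnorm u <= e * K) -> u = 0.
Proof.
move=> uK; apply/hnorm_eq0/le_anti; rewrite hnorm_ge0 andbT; apply/ler_addgt0Pr => e e0.
have K0 : 0 < `|K| + 1 by rewrite ltr_wpDl.
apply: le_trans (uK _ (divr_gt0 e0 K0)) _.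
rewrite add0r mulrAC ler_pdivrMr// ler_pM2l//.
by apply: le_trans (ler_norm _) _; rewrite lerDl.
Qed.

Lemma positive_op_sym E (T : E -> E) : positive_op T -> forall u v, rdot (T u) v = rdot u (T v).
Proof.
move=> [[linT _] T0] u v.
have Im0 w : rdot (T w) ('i *: w) = 0.
  have := T0 w; rewrite lecE => /andP[/eqP + _].
  by rewrite herm_ReIm.
(* Polarization: at this vector the diagonal terms vanish and the cross terms are <T u, v> - <T v,
   u>. *)
have := Im0 (u - 'i *: v).
rewrite opB// opZ// scalerBr scalerA -expr2 sqr_i scaleN1r opprK.
rewrite rdotDr !rdotBl Im0 rdot_iM rdot_il Im0 (rdotC u); lra.
Qed.

Lemma positive_op_ge0 E (T : E -> E) : positive_op T -> forall u, 0 <= rdot (T u) u.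
Proof. by move=> [_ T0] u; have := T0 u; rewrite lecE => /andP[]. Qed.

Lemma positive_opI E (T : E -> E) : bounded_op T ->
  (forall u v, rdot (T u) v = rdot u (T v)) -> (forall u, 0 <= rdot (T u) u) -> positive_op T.
Proof.
move=> bT symT T0; have [linT _] := bT; split=> // u; rewrite lecE T0 andbT /=.
rewrite herm_ReIm /=; have := symT u ('i *: u); rewrite opZ// -[rdot u ('i *: T u)]opprK -rdot_il.
by rewrite (rdotC ('i *: u)) => H; apply/eqP; lra.
Qed.

Section Contraction.
Variables (E : hermType R) (T : E -> E).
Hypothesis cE : hcomplete E.
Hypothesis linT : linear T.
Hypothesis symT : forall u v, rdot (T u) v = rdot u (T v).
Hypothesis T_ge0 : forall u, 0 <= rdot (T u) u.
Hypothesis T_le1 : forall u, hnorm (T u) <= hnorm u.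

Let half : R[i] := (2^-1)%:C.

Let rdot_half (u v : E) : rdot (half *: u) v = 2^-1 * rdot u v.
Proof. exact: rdotZl. Qed.

Let hnorm_half (u : E) : hnorm (half *: u) = 2^-1 * hnorm u.
Proof. by rewrite hnormZ ger0_norm// invr_ge0. Qed.

Let half_double (u : E) : half *: (u + u) = u.
Proof.
rewrite -mulr2n -scaler_nat scalerA.
have -> : half * 2 = 1.
  have -> : (2 : R[i]) = (2 : R)%:C by rewrite rmorph_nat.
  by rewrite -rmorphM mulVf ?pnatr_eq0.
by rewrite scale1r.
Qed.

Let C u := u - T u.

Let linC : linear C.
Proof. by move=> a u v; rewrite /C linT scalerBr opprD addrACA. Qed.

Let symC (u v : E) : rdot (C u) v = rdot u (C v).
Proof. by rewrite rdotBl rdotBr symT. Qed.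

(** Expanding the square, it is enough that |T u|^2 is at most <T u, u>. This is Cauchy-Schwarz for
    the form <T u, v>, applied to u and T u, together with the contraction property of [T]. *)
Let C_le1 u : hnorm (C u) <= hnorm u.
Proof.
apply: hnorm_le; first exact: hnorm_ge0.
rewrite hnorm_sqr rdotBl !rdotBr (rdotC u (T u)).
suff : rdot (T u) (T u) <= rdot (T u) u by have := T_ge0 u; lra.
have H : rdot (T u) (T u) ^+ 2 <= rdot (T u) u * rdot (T (T u)) (T u).
  apply: (form_cauchy_schwarz (q := fun u v : E => rdot (T u) v)) => //.
  - by move=> v w; rewrite symT rdotC.
  - by move=> v w x; rewrite opD// rdotDl.
  - by move=> r v w; rewrite opZ// rdotZl.
have TT : rdot (T (T u)) (T u) <= rdot (T u) (T u).
  rewrite -[X in _ <= X]hnorm_sqr expr2; apply: le_trans (rdot_le _ _) _.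
  by rewrite ler_wpM2r ?hnorm_ge0.
have [->|Tu0] := eqVneq (rdot (T u) (T u)) 0; first exact: T_ge0.
have Tu1 : 0 < rdot (T u) (T u) by rewrite lt0r Tu0 rdot_ge0.
rewrite -(ler_pM2r Tu1) -expr2; apply: le_trans H _.
by rewrite ler_wpM2l ?T_ge0.
Qed.

(* The increasing iteration Y = (1 - T + Y^2) / 2, whose limit is 1 - sqrt T. It
   is dominated by the scalar iteration y = (1 + y^2) / 2, which increases to 1. *)
Fixpoint Y n u := if n is n'.+1 then half *: (C u + Y n' (Y n' u)) else 0.

Fixpoint y n : R := if n is n'.+1 then 2^-1 * (1 + y n' ^+ 2) else 0.

Let y_ge0 n : 0 <= y n.
Proof. by case: n => //= n; have := sqr_ge0 (y n); lra. Qed.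
Let y_le1 n : y n <= 1.
Proof. by elim: n => [|n IH] /=; [lra|have := y_ge0 n; nra]. Qed.
Let y_step n : y n <= y n.+1.
Proof. by rewrite /=; have := sqr_ge0 (1 - y n); lra. Qed.
Let y_nd : {homo y : m n / (m <= n)%N >-> m <= n}.
Proof. exact: homo_leq (@lexx _ _) (@le_trans _ _) y_step. Qed.

Let linY n : linear (Y n).
Proof.
elim: n => [|n IH] a u v /=; first by rewrite scaler0 addr0.
rewrite linC !IH [a *: (half *: _)]scalerA (mulrC a) -scalerA -scalerDr.
congr (half *: _).
by rewrite (scalerDr a (C u)) addrACA.
Qed.

Let symY n u v : rdot (Y n u) v = rdot u (Y n v).
Proof.
elim: n u v => [|n IH] u v /=; first by rewrite rdot0l rdot0r.
by rewrite rdot_half rdotC rdotC rdotZr rdotDl rdotDr symC !IH.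
Qed.

(** Each [Y n] is a polynomial in [C], so it commutes with whatever commutes with [C]: first [C]
    itself, then every [Y m]. *)
Let Y_comm n (X : E -> E) : linear X -> (forall u, X (C u) = C (X u)) ->
  forall u, X (Y n u) = Y n (X u).
Proof.
move=> linX XC; elim: n => [|n IH] u /=; first by rewrite op0.
by rewrite opZ// opD// XC !IH.
Qed.

Let YC n u : Y n (C u) = C (Y n u).
Proof. by rewrite (Y_comm n linC). Qed.

Let YY m n u : Y m (Y n u) = Y n (Y m u).
Proof. by apply: Y_comm => //; exact: YC. Qed.

Let Y_le n u : hnorm (Y n u) <= y n * hnorm u.
Proof.
elim: n u => [|n IH] u /=; first by rewrite hnorm0 mul0r.
rewrite hnorm_half -mulrA ler_wpM2l ?invr_ge0//.
apply: le_trans (hnormD _ _) _; rewrite mulrDl mul1r lerD// expr2 -mulrA.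
by apply: le_trans (IH _) _; rewrite ler_wpM2l.
Qed.

(** As the iterates commute, successive differences factor as a difference of squares. The scalar
    iteration has the same factorization, so its increments dominate by induction. *)
Let Y_step n u : hnorm (Y n.+1 u - Y n u) <= (y n.+1 - y n) * hnorm u.
Proof.
elim: n u => [|n IH] u; first by rewrite !subr0; exact: (Y_le 1).
have -> : Y n.+2 u - Y n.+1 u =
    half *: (Y n.+1 (Y n.+1 u - Y n u) + Y n (Y n.+1 u - Y n u)).
  have YS k (v : E) : Y k.+1 v = half *: (C v + Y k (Y k v)) by [].
  move: (YS n.+1 u) (YS n u) (YY n n.+1 u) (linY n.+1) (linY n).
  move: (Y n.+2) (Y n.+1) (Y n) => Y2 Y1 Y0 EY2 EY1 comm linY1 linY0.
  rewrite (opB linY1) (opB linY0) EY2 -comm; apply: rdot_ext => w.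
  have := congr1 (fun x => rdot x w) EY1.
  by rewrite !(rdotDl, rdotNl, rdot_half); lra.
have -> : y n.+2 - y n.+1 = 2^-1 * (y n.+1 + y n) * (y n.+1 - y n).
  have yS k : y k.+1 = 2^-1 * (1 + y k ^+ 2) by [].
  have -> : 2^-1 * (y n.+1 + y n) * (y n.+1 - y n) =
    2^-1 * y n.+1 ^+ 2 - 2^-1 * y n ^+ 2 by ring.
  by have := yS n.+1; have := yS n; lra.
rewrite hnorm_half -!mulrA ler_wpM2l ?invr_ge0//.
apply: le_trans (hnormD _ _) _; rewrite mulrDl lerD//.
all: apply: le_trans (Y_le _ _) _; rewrite ler_wpM2l//; exact: IH.
Qed.

Let Y_diff m n u : (n <= m)%N -> hnorm (Y m u - Y n u) <= (y m - y n) * hnorm u.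
Proof.
elim: m => [|m IH]; first by rewrite leqn0 => /eqP ->; rewrite !subrr hnorm0 mul0r.
rewrite leq_eqVlt => /predU1P[->|]; first by rewrite !subrr hnorm0 mul0r.
rewrite ltnS => /IH {}IH; apply: le_trans (hnormBD _ (Y m u) _) _.
have -> : y m.+1 - y n = (y m.+1 - y m) + (y m - y n) by ring.
by rewrite mulrDl lerD.
Qed.

Lemma sqrt_exists_contraction : exists S : E -> E, positive_op S /\ S \o S = T.
Proof.
have Y_cvg u : exists l, hcvg (fun n => Y n u) l.
  apply: cE => e e0.
  have u0 : 0 < hnorm u + 1 by rewrite ltr_wpDl// hnorm_ge0.
  have [N yN] := nondecreasing_bounded_cauchy y_nd y_le1 (divr_gt0 e0 u0).
  exists N => m n Nn nm; apply: le_trans (Y_diff _ nm) _.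
  apply: le_trans (ler_wpM2r (hnorm_ge0 _) (yN _ _ Nn nm)) _.
  by rewrite mulrAC ler_pdivrMr// ler_pM2l// lerDl.
have [Z YZ] := choice Y_cvg.
(* The bounds are proportional to |u|, so the convergence is in operator norm and one index serves
   all the vectors in the limit arguments that follow. *)
have unif e : 0 < e -> exists N, forall n u, (N <= n)%N -> hnorm (Z u - Y n u) <= e * hnorm u.
  move=> e0; have [N yN] := nondecreasing_bounded_cauchy y_nd y_le1 e0.
  exists N => n u Nn; apply/ler_addgt0Pr => d d0.
  have [M ZM] := YZ u _ d0; set m := maxn n M.
  apply: le_trans (hnormBD _ (Y m u) _) _; rewrite addrC lerD//.
    apply: le_trans (Y_diff _ (leq_maxl _ _)) _.
    by rewrite ler_wpM2r ?hnorm_ge0// yN// leq_maxl.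
  by rewrite hnormB ZM// leq_maxr.
have symZ u v : rdot (Z u) v = rdot u (Z v).
  apply/eqP; rewrite -subr_eq0 -normr_le0; apply/ler_addgt0Pr => e e0.
  have K0 : 0 < hnorm u * hnorm v + 1 by rewrite ltr_wpDl// mulr_ge0// hnorm_ge0.
  have [N ZN] := unif _ (divr_gt0 (divr_gt0 e0 K0) (ltr0Sn _ 1)).
  have -> : rdot (Z u) v - rdot u (Z v) =
      rdot (Z u - Y N u) v - rdot u (Z v - Y N v) by rewrite rdotBl rdotBr symY; ring.
  have := ler_wpM2r (hnorm_ge0 v) (ZN _ u (leqnn N)).
  have := ler_wpM2l (hnorm_ge0 u) (ZN _ v (leqnn N)).
  have := cauchy_schwarz (Z u - Y N u) v; have := cauchy_schwarz u (Z v - Y N v).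
  have := ler_normB (rdot (Z u - Y N u) v) (rdot u (Z v - Y N v)).
  have eK : e / (hnorm u * hnorm v + 1) * (hnorm u * hnorm v) <= e.
    by rewrite mulrAC ler_pdivrMr// ler_pM2l// lerDl.
  by lra.
have Z_le1 u : hnorm (Z u) <= hnorm u.
  apply/ler_addgt0Pr => e e0; have [N ZN] := YZ u _ e0.
  rewrite -[Z u](subrK (Y N u)) addrC; apply: le_trans (hnormD _ _) _.
  rewrite lerD ?(hnormB (Z u)) ?ZN//; apply: le_trans (Y_le _ _) _.
  by rewrite -[X in _ <= X]mul1r ler_wpM2r ?hnorm_ge0.
have linZ : linear Z.
  move=> a u v; apply/eqP; rewrite -subr_eq0; apply/eqP.
  apply: (hnorm_small (K := hnorm (a *: u + v) + Num.sqrt (sqn a) * hnorm u + hnorm v)).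
  move=> e /unif[N ZN].
  have -> : Z (a *: u + v) - (a *: Z u + Z v) = (Z (a *: u + v) - Y N (a *: u + v)) -
      (a *: (Z u - Y N u) + (Z v - Y N v)).
    rewrite linY scalerBr; apply: rdot_ext => w; rewrite !(rdotDl, rdotNl); lra.
  apply: le_trans (hnormD _ _) _; rewrite hnormN -addrA mulrDr lerD ?ZN//.
  apply: le_trans (hnormD _ _) _; rewrite mulrDr lerD ?ZN// hnorm_scale mulrCA.
  by rewrite ler_wpM2l ?sqrtr_ge0// ZN.
(* The limit solves 2 Z = C + Z^2, that is (1 - Z)^2 = 1 - C = T. The constant 4 counts the errors:
   one for each factor of Z^2 and two for 2 Z. *)
have fixZ u : C u + Z (Z u) = Z u + Z u.
  apply/eqP; rewrite -subr_eq0; apply/eqP; apply: (hnorm_small (K := 4 * hnorm u)).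
  move=> e e0; have [N ZN] := unif _ e0.
  have YN : C u + Y N (Y N u) = Y N.+1 u + Y N.+1 u by rewrite -scalerDr half_double.
  have -> : C u + Z (Z u) - (Z u + Z u) = (Z (Z u) - Y N (Z u)) + Y N (Z u - Y N u) -
      ((Z u - Y N.+1 u) + (Z u - Y N.+1 u)).
    apply: rdot_ext => w; have := congr1 (fun x => rdot x w) YN.
    rewrite (opB (linY N)) !(rdotDl, rdotNl); lra.
  apply: le_trans (hnormD _ _) _; rewrite hnormN.
  have := hnormD (Z (Z u) - Y N (Z u)) (Y N (Z u - Y N u)).
  have := hnormD (Z u - Y N.+1 u) (Z u - Y N.+1 u).
  have := ZN _ (Z u) (leqnn N); have := ZN _ u (leqnn N); have := ZN _ u (leqnSn N).
  have := Y_le N (Z u - Y N u); have := ler_wpM2r (hnorm_ge0 (Z u - Y N u)) (y_le1 N).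
  have : e * hnorm (Z u) <= e * hnorm u by rewrite ler_wpM2l// ltW.
  by lra.
exists (fun u => u - Z u); split.
  apply: positive_opI.
  - apply: bounded_opD (bounded_op_id E) (bounded_opN _).
    by split=> //; exists 1 => u; rewrite mul1r.
  - by move=> u v; rewrite rdotBl rdotBr symZ.
  - move=> u; rewrite rdotBl subr_ge0; apply: le_trans (rdot_le _ _) _.
    by rewrite -hnorm_sqr expr2 ler_wpM2r ?hnorm_ge0.
apply/funext => u /=; apply: rdot_ext => w; have := congr1 (fun x => rdot x w) (fixZ u).
rewrite opB// /C !(rdotDl, rdotNl); lra.
Qed.

End Contraction.

(** Dividing by a bound of [T] reduces to a contraction; the root is then multiplied by the square
    root of that bound. *)
Lemma sqrt_exists E (T : E -> E) : hcomplete E -> positive_op T ->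
  exists S : E -> E, positive_op S /\ S \o S = T.
Proof.
move=> cE pT; have [bT _] := pT; have [linT _] := bT; have [C C0 TC] := bop_pos bT.
have [|||u|S [pS SS]] := @sqrt_exists_contraction E (fun u => (C^-1)%:C *: T u) cE.
- by move=> a u v; rewrite linT scalerDr scalerA mulrC -scalerA.
- by move=> u v; rewrite rdotZl rdotZr positive_op_sym.
- by move=> u; rewrite rdotZl mulr_ge0 ?positive_op_ge0// invr_ge0 ltW.
- by rewrite hnormZ gtr0_norm ?invr_gt0// ler_pdivrMl.
have [[linS _] _] := pS.
pose c := Num.sqrt C; exists (fun u => c%:C *: S u); split.
  apply: positive_opI.
  - have [[_ [D SD]] _] := pS; split.
      by move=> a u v; rewrite linS scalerDr scalerA mulrC -scalerA.
    exists (c * D) => u; rewrite hnormZ ger0_norm ?sqrtr_ge0// -mulrA.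
    by rewrite ler_wpM2l ?sqrtr_ge0.
  - by move=> u v; rewrite rdotZl rdotZr positive_op_sym.
  - by move=> u; rewrite rdotZl mulr_ge0 ?positive_op_ge0// sqrtr_ge0.
apply/funext => u /=; rewrite opZ// scalerA -rmorphM -expr2 sqr_sqrtr ?ltW//.
have /= -> := congr1 (fun f => f u) SS.
by rewrite scalerA -rmorphM mulfV ?gt_eqF// scale1r.
Qed.

End PositiveSquareRoot.

(** * Trace class by means of finite Bessel systems *)

Section Nuclear.
Variable R : realType.
Implicit Types E F G : hermType R.

(** With [rdot] in place of [herm], the condition is stable under contractions that are only real
    linear, such as those of [finite_polar]. The price is the factor 2 in [hs_bessel]. *)
Definition bessel E (s : seq E) := forall v, \sum_(x <- s) rdot v x ^+ 2 <= rdot v v.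

(** The least such [C] lies between the trace norm and its double. Since neither |A| nor a basis is
    mentioned, the notion is visibly additive and stable under contractions on both sides. *)
Definition nuclear E F (A : E -> F) := exists C : R, forall s : seq (E * F),
  bessel [seq p.1 | p <- s] -> bessel [seq p.2 | p <- s] ->
  \sum_(p <- s) rdot (A p.1) p.2 <= C.

(** Having the adjoint [W'] as data avoids an existence theorem for maps that are not complex
    linear. *)
Definition contraction_pair E F (W : E -> F) (W' : F -> E) :=
  [/\ forall u v, rdot (W u) v = rdot u (W' v), forall u, hnorm (W u) <= hnorm u &
      forall v, hnorm (W' v) <= hnorm v].

Lemma contraction_pairC E F (W : E -> F) (W' : F -> E) :
  contraction_pair W W' -> contraction_pair W' W.
Proof. by case=> WW' W1 W'1; split=> // u v; rewrite rdotC -WW' rdotC. Qed.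

Lemma bessel_contraction E F (W : E -> F) (W' : F -> E) s :
  contraction_pair W W' -> bessel s -> bessel [seq W u | u <- s].
Proof.
move=> [WW' _ W'1] bs v; rewrite big_map.
under eq_bigr do rewrite rdotC WW' rdotC.
by apply: le_trans (bs _) _; rewrite -!hnorm_sqr ler_pXn2r ?nnegrE ?hnorm_ge0.
Qed.

Section Polar.
Variables (E F : hermType R) (A : E -> F) (P : E -> E).
Hypotheses (linA : linear A) (linP : linear P).
Hypothesis AP : forall u v, rdot (A u) (A v) = rdot (P u) (P v).

(** When it fixes every [P w], this is the real orthogonal projection onto their span. That
    condition serves as the invariant in place of orthonormality. *)
Let Q ws u := \sum_(w <- ws) (rdot u (P w))%:C *: P w.

Let symQ ws u v : rdot (Q ws u) v = rdot u (Q ws v).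
Proof.
rewrite rdot_suml rdot_sumr; apply: eq_bigr => w _.
by rewrite rdotZl rdotZr mulrC (rdotC v).
Qed.

Let QD ws u v : Q ws (u + v) = Q ws u + Q ws v.
Proof. by rewrite -big_split; apply: eq_bigr => w _; rewrite rdotDl rmorphD scalerDl. Qed.
Let QZ ws r u : Q ws (r%:C *: u) = r%:C *: Q ws u.
Proof. by rewrite scaler_sumr; apply: eq_bigr => w _; rewrite rdotZl rmorphM scalerA. Qed.

Let Q_idem ws u : (forall w, List.In w ws -> Q ws (P w) = P w) -> Q ws (Q ws u) = Q ws u.
Proof.
move=> Qw; suff H t : (forall w, List.In w t -> List.In w ws) -> Q ws (Q t u) = Q t u by apply: H.
elim: t => [|w t IH] tws.
  by rewrite /Q big_nil big1// => w _; rewrite rdot0l scale0r.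
have -> : Q (w :: t) u = (rdot u (P w))%:C *: P w + Q t u by rewrite /Q big_cons.
rewrite QD QZ Qw; last by apply: tws; left.
by rewrite IH// => w' w't; apply: tws; right.
Qed.

(* Gram-Schmidt for the form <P u, P v>. *)
Let orthonormalize (xs : seq E) : exists ws,
  (forall w, List.In w ws -> Q ws (P w) = P w) /\
  (forall x, List.In x xs -> Q ws (P x) = P x).
Proof.
elim: xs => [|x xs [ws [Qw Qx]]]; first by exists [::].
(* Subtracting before [P] is applied keeps the new vector of the form [P y], so that [A y] is
   available as its image under [W]. *)
pose y := x - \sum_(w <- ws) (rdot (P x) (P w))%:C *: w.
have Py : P y = P x - Q ws (P x).
  by rewrite /y opB// op_sum//; congr (_ - _); apply: eq_bigr => w _; rewrite opZ.
have [y0|y0] := eqVneq (hnorm (P y)) 0.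
  exists ws; split=> // z [<-|/Qx//].
  by apply/esym/eqP; rewrite -subr_eq0 -Py; apply/eqP/hnorm_eq0.
pose r := (hnorm (P y))^-1; pose w' := r%:C *: y.
have Pw' : P w' = r%:C *: P y by rewrite opZ.
have QE u : Q (w' :: ws) u = (rdot u (P w'))%:C *: P w' + Q ws u by rewrite /Q big_cons.
have ortho u : Q ws u = u -> rdot u (P w') = 0.
  by move=> Qu; rewrite Pw' rdotZr Py rdotBr -symQ Qu subrr mulr0.
have fixes u : Q ws u = u -> Q (w' :: ws) u = u.
  by move=> Qu; rewrite QE ortho// Qu scale0r add0r.
have Qw' : Q (w' :: ws) (P w') = P w'.
  have -> : Q (w' :: ws) (P w') = (rdot (P w') (P w'))%:C *: P w' + Q ws (P w') by [].
  have -> : rdot (P w') (P w') = 1.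
    by rewrite Pw' rdotZl rdotZr -hnorm_sqr /r; field.
  have QPy : Q ws (P y) = 0.
    apply: rdot_ext => u; rewrite symQ Py rdotBl [rdot (Q ws _) _]symQ.
    by rewrite Q_idem// subrr rdot0l.
  by rewrite scale1r Pw' QZ QPy scaler0 addr0.
exists (w' :: ws); split.
  by move=> w [<-//|/Qw]; exact: fixes.
move=> z [<-|/Qx]; last exact: fixes.
have -> : P x = (hnorm (P y))%:C *: P w' + Q ws (P x).
  rewrite Pw' scalerA -rmorphM /r divff// scale1r Py subrK//.
by rewrite QD QZ Qw' (fixes (Q ws _))// Q_idem.
Qed.

(* A = W |A| and |A| = W^* A on finitely many vectors, which avoids extending W
   to the closure of the range. *)
Lemma finite_polar (xs : seq E) : exists W W', contraction_pair W W' /\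
  forall x, List.In x xs -> W (P x) = A x /\ W' (A x) = P x.
Proof.
have [ws [Qw Qx]] := orthonormalize xs.
(* The coefficients are those of [Q ws u], with [A w] in place of [P w]. By [AP] both sums have the
   same norm, so [W] is a contraction because the projection is. *)
pose W u := \sum_(w <- ws) (rdot u (P w))%:C *: A w.
pose W' v := \sum_(w <- ws) (rdot v (A w))%:C *: P w.
exists W, W'.
have WW' u v : rdot (W u) v = rdot u (W' v).
  rewrite rdot_suml rdot_sumr; apply: eq_bigr => w _.
  by rewrite rdotZl rdotZr mulrC (rdotC v).
have Q_le u : rdot (Q ws u) (Q ws u) <= hnorm u ^+ 2.
  have QQ : rdot (Q ws u) (Q ws u) = rdot (Q ws u) u by rewrite -symQ Q_idem.
  rewrite hnorm_sqr; have := rdot_ge0 (u - Q ws u).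
  by rewrite rdotBl !rdotBr (rdotC u (Q _ _)) QQ; lra.
have WA u : W u = A (\sum_(w <- ws) (rdot u (P w))%:C *: w).
  by rewrite op_sum//; apply: eq_bigr => w _; rewrite opZ.
have QP u : Q ws u = P (\sum_(w <- ws) (rdot u (P w))%:C *: w).
  by rewrite op_sum//; apply: eq_bigr => w _; rewrite opZ.
have W_le u : hnorm (W u) <= hnorm u.
  by apply: hnorm_le; [exact: hnorm_ge0|rewrite WA AP -QP].
split.
  split=> // v; apply: hnorm_le; first exact: hnorm_ge0.
  rewrite -WW'; apply: le_trans (rdot_le _ _) _; rewrite expr2 ler_wpM2r ?hnorm_ge0//.
  apply: le_trans (W_le _) _.
  have [->|v0] := eqVneq (hnorm (W' v)) 0; first exact: hnorm_ge0.
  have v1 : 0 < hnorm (W' v) by rewrite lt0r v0 hnorm_ge0.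
  rewrite -(ler_pM2l v1) -expr2 hnorm_sqr -WW'; apply: le_trans (rdot_le _ _) _.
  by rewrite ler_wpM2r ?hnorm_ge0.
move=> x /Qx QPx; split.
  apply/eqP; rewrite -subr_eq0; apply/eqP/rdot_eq0.
  by rewrite WA -opB// AP opB// -QP QPx subrr rdot0l.
by rewrite -[RHS]QPx; apply: eq_bigr => w _; rewrite AP.
Qed.
End Polar.

Lemma sum_iota (f : nat -> R) N : \sum_(k <- iota 0 N) f k = \sum_(i < N) f i.
Proof. by rewrite -(big_mkord xpredT f) /index_iota subn0. Qed.

Lemma eq_sum_in T (s : seq T) (f g : T -> R) :
  (forall x, List.In x s -> f x = g x) -> \sum_(x <- s) f x = \sum_(x <- s) g x.
Proof.
elim: s => [|a s IH] fg; rewrite ?big_nil// !big_cons fg; last by left.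
by rewrite IH// => x xs; apply: fg; right.
Qed.

(** Expand |S x|^2 in the basis [e], move [S] to the other side and exchange the sums. Bessel's
    inequality bounds the inner sum by |S' e_k|^2, once for the real and once for the imaginary
    parts, hence the factor 2. *)
Lemma hs_bessel E F (e : nat -> E) (S : F -> E) (S' : E -> F) (C : R) xs :
    hcomplete E -> hilbert_basis e -> linear S' ->
    (forall u v, rdot (S u) v = rdot u (S' v)) ->
    (forall N, \sum_(k < N) hnorm (S' (e k)) ^+ 2 <= C) ->
  bessel xs -> \sum_(x <- xs) rdot (S x) (S x) <= 2 * C.
Proof.
move=> cE eB linS' SS' SC bxs.
rewrite -(big_map S xpredT (fun u => rdot u u)); apply: parseval_le cE eB _ => N.
rewrite big_map exchange_big /=.
apply: (@le_trans _ _ (\sum_(k <- iota 0 N) 2 * hnorm (S' (e k)) ^+ 2)); last first.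
  by rewrite -mulr_sumr sum_iota ler_pM2l.
apply: ler_sum => k _; under eq_bigr do rewrite sqn_herm !SS'.
rewrite big_split /=.
under eq_bigr do rewrite rdotC.
under [X in _ + X]eq_bigr do rewrite rdotC opZ//.
rewrite hnorm_sqr; have := bxs (S' (e k)); have := bxs ('i *: S' (e k)).
by rewrite rdot_iM; lra.
Qed.

Lemma adj_positive E F (A : E -> F) : bounded_op A -> is_adjoint A (adj A) ->
  positive_op (adj A \o A).
Proof.
move=> bA [bA' AA']; apply: positive_opI; first exact: bounded_op_comp.
  by move=> u v; rewrite /= /rdot -AA' herm_conj -AA' -herm_conj.
by move=> u; rewrite rdotC /rdot -AA' -/(rdot _ _) rdot_ge0.
Qed.

Lemma abs_opP E F (e : nat -> E) (A : E -> F) : hcomplete E -> hilbert_basis e -> bounded_op A ->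
  positive_op (abs_op A) /\ forall u v, rdot (A u) (A v) = rdot (abs_op A u) (abs_op A v).
Proof.
move=> cE eB bA; have AA' := adjP cE eB bA.
have [P PA] := sqrt_exists cE (adj_positive bA AA').
have [pA AE] : [set P : E -> E | positive_op P /\ P \o P = adj A \o A] (abs_op A).
  by apply: xgetPex; exists P.
split=> // u v; rewrite positive_op_sym//; have /= -> := congr1 (fun f => f v) AE.
by rewrite /rdot AA'.2.
Qed.

(** Let S be the square root of |A|; the sum of the |S e_k|^2 is the one that defines trace class.
    With A = W |A| on the given vectors, <A x, y> = <S x, S W' y> is at most half the sum of the two
    squared norms, and the W' y again form a Bessel system. *)
Lemma trace_class_nuclear E F (A : E -> F) : hcomplete E -> trace_class A -> nuclear A.
Proof.
move=> cE [bA [e eB A_cvg]]; have [pP AP] := abs_opP cE eB bA.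
have [linA _] := bA; have [[linP _] _] := pP.
have [S [pS SS]] := sqrt_exists cE pP; have [[linS _] _] := pS.
have symS := positive_op_sym pS.
have SE u v : rdot (abs_op A u) v = rdot (S u) (S v) by rewrite -SS /= symS.
have [C SC] := nneg_series_bounded (fun n => positive_op_ge0 pP (e n)) A_cvg.
have SC' N : \sum_(k < N) hnorm (S (e k)) ^+ 2 <= C.
  by apply: le_trans (SC N); apply: ler_sum => k _; rewrite hnorm_sqr -SE.
exists (2 * C) => s b1 b2.
have [W [W' [WW' WA]]] := finite_polar linA linP AP [seq p.1 | p <- s].
have b3 := bessel_contraction (contraction_pairC WW') b2.
have H1 := hs_bessel cE eB linS symS SC' b1.
have H2 := hs_bessel cE eB linS symS SC' b3.
rewrite !big_map in H1 H2.
apply: (@le_trans _ _ (\sum_(p <- s) 2^-1 *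
  (rdot (S p.1) (S p.1) + rdot (S (W' p.2)) (S (W' p.2))))); last first.
  by rewrite -mulr_sumr big_split /=; lra.
have -> : \sum_(p <- s) rdot (A p.1) p.2 = \sum_(p <- s) rdot (S p.1) (S (W' p.2)).
  apply: eq_sum_in => p ps; have [<- _] := WA p.1 (List.in_map (fun p => p.1) _ _ ps).
  by case: WW' => -> _ _; rewrite SE.
apply: ler_sum => p _; have := rdot_ge0 (S p.1 - S (W' p.2)).
by rewrite rdotBl !rdotBr (rdotC (S (W' _)) (S p.1)); lra.
Qed.

Lemma bessel_basis E (e : nat -> E) N : hilbert_basis e -> bessel [seq e k | k <- iota 0 N].
Proof.
move=> [eON _] v; apply: le_trans (bessel_ineq eON v N); rewrite big_map.
by apply: ler_sum => k _; rewrite sqn_herm lerDl sqr_ge0.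
Qed.

(** Test [A] on the pairs (e_k, W e_k): <A e_k, W e_k> = <W' A e_k, e_k> = <|A| e_k, e_k>. *)
Lemma nuclear_trace_class E F (e : nat -> E) (A : E -> F) :
  hcomplete E -> hilbert_basis e -> bounded_op A -> nuclear A -> trace_class A.
Proof.
move=> cE eB bA [C AC]; have [pP AP] := abs_opP cE eB bA.
have [linA _] := bA; have [[linP _] _] := pP.
split=> //; exists e => //; apply: (nneg_series_cvg (C := C)).
  by move=> n; exact: positive_op_ge0.
move=> N; rewrite -(sum_iota (fun k => complex.Re (herm (abs_op A (e k)) (e k)))).
pose xs := [seq e k | k <- iota 0 N].
have [W [W' [WW' WA]]] := finite_polar linA linP AP xs.
have bxs : bessel xs := bessel_basis N eB.
have bW := bessel_contraction WW' bxs.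
have map1 l : [seq p.1 | p <- [seq (x, W x) | x <- l]] = l by elim: l => //= a l ->.
have map2 l : [seq p.2 | p <- [seq (x, W x) | x <- l]] = [seq W x | x <- l].
  by elim: l => //= a l ->.
have := AC [seq (x, W x) | x <- xs]; rewrite map1 map2 big_map.
move=> /(_ bxs bW); apply: le_trans.
rewrite -(big_map e xpredT (fun x => complex.Re (herm (abs_op A x) x))) -/xs.
rewrite le_eqVlt; apply/orP; left; apply/eqP/eq_sum_in => x xin /=.
have [_ <-] := WA x xin.
by have [+ _ _] := contraction_pairC WW'; exact.
Qed.

Lemma nuclearD E F (A B : E -> F) : nuclear A -> nuclear B -> nuclear (A \+ B).
Proof.
move=> [C AC] [D BD]; exists (C + D) => s b1 b2.
under eq_bigr do rewrite /= rdotDl.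
by rewrite big_split lerD ?AC ?BD.
Qed.

Lemma nuclear_contraction_r E F G (A : F -> G) (W : E -> F) (W' : F -> E) :
  contraction_pair W W' -> nuclear A -> nuclear (A \o W).
Proof.
move=> WW' [C AC]; exists C => s b1 b2.
have := AC [seq (W p.1, p.2) | p <- s]; rewrite big_map -!map_comp; apply=> //.
by have := bessel_contraction WW' b1; rewrite -map_comp.
Qed.

Lemma nuclear_contraction_l E F G (A : E -> F) (W : F -> G) (W' : G -> F) :
  contraction_pair W W' -> nuclear A -> nuclear (W \o A).
Proof.
move=> WW' [C AC]; exists C => s b1 b2; have [adjW _ _] := WW'.
under eq_bigr do rewrite /= adjW.
have := AC [seq (p.1, W' p.2) | p <- s]; rewrite big_map -!map_comp; apply=> //.
by have := bessel_contraction (contraction_pairC WW') b2; rewrite -map_comp.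
Qed.

End Nuclear.

(** * Unitary operators acting on adjoints, traces and operator ideals *)

Section UnitaryPairs.
Variable R : realType.
Implicit Types E F G : hermType R.

Definition unitary_pair E F (U : E -> F) (U' : F -> E) :=
  [/\ bounded_op U, bounded_op U', cancel U U', cancel U' U &
      forall u v, herm (U u) v = herm u (U' v)].

Lemma unitary_pairC E F (U : E -> F) U' : unitary_pair U U' -> unitary_pair U' U.
Proof. by case=> bU bU' UK U'K UU'; split=> // u v; rewrite herm_conj -UU' -herm_conj. Qed.

Lemma unitary_isometry E F (U : E -> F) U' : unitary_pair U U' ->
  forall u v, herm (U u) (U v) = herm u v.
Proof. by move=> [_ _ UK _ UU'] u v; rewrite UU' UK. Qed.

Lemma unitary_hnorm E F (U : E -> F) U' : unitary_pair U U' -> forall u, hnorm (U u) = hnorm u.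
Proof. by move=> UP u; rewrite /hnorm (unitary_isometry UP). Qed.

Lemma unitary_contraction E F (U : E -> F) U' : unitary_pair U U' -> contraction_pair U U'.
Proof.
move=> UP; split=> [u v|u|v]; last 2 first.
- by rewrite (unitary_hnorm UP).
- by rewrite (unitary_hnorm (unitary_pairC UP)).
by case: UP => _ _ _ _ UU'; rewrite /rdot UU'.
Qed.

Lemma unitary_basis E F (U : E -> F) U' e : unitary_pair U U' ->
  hilbert_basis e -> hilbert_basis (U \o e).
Proof.
move=> UP [eON e_tot]; split=> [m n|u ue].
  by rewrite /= (unitary_isometry UP) eON.
have [bU _ _ U'K UU'] := UP; have [linU _] := bU.
rewrite -[u]U'K (e_tot (U' u)) ?(op0 linU)//.
by move=> n; rewrite herm_conj -UU' -herm_conj ue.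
Qed.

Lemma adj0 E F (A : E -> F) : ~ (exists B, is_adjoint A B) -> adj A = fun=> 0.
Proof.
move=> noB; rewrite /adj; case: xgetP => // B _ AB.
by case: noB; exists B.
Qed.

Lemma adj_is_adjoint E F (A : E -> F) : (exists B, is_adjoint A B) -> is_adjoint A (adj A).
Proof. by move=> exB; apply: xgetPex. Qed.

(* When M has no bounded adjoint, both sides are the junk value 0. *)
Lemma adj_unitary_r E F G (M : F -> G) (U : E -> F) U' : unitary_pair U U' ->
  adj (M \o U) = U' \o adj M.
Proof.
move=> UP; have [bU bU' UK U'K UU'] := UP; have [[B MB]|noB] := pselect (exists B, is_adjoint M B).
  have [bM' MM'] := adj_is_adjoint (ex_intro _ B MB).
  apply: adj_eq; split; first exact: bounded_op_comp.
  by move=> u v; rewrite /= MM' UU'.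
rewrite (adj0 noB) adj0.
  by apply/funext => v /=; rewrite op0//; case: bU'.
move=> [N [bN MUN]]; apply: noB; exists (U \o N); split; first exact: bounded_op_comp.
move=> u v; rewrite -[u in LHS]U'K -[herm (M _) _]/(herm ((M \o U) (U' u)) v) MUN.
by rewrite /= herm_conj -UU' -herm_conj.
Qed.

Lemma adj_unitary_l E F G (A : E -> F) (U : F -> G) U' : unitary_pair U U' ->
  adj (U \o A) = adj A \o U'.
Proof.
move=> UP; have [bU bU' UK U'K UU'] := UP; have [[B AB]|noB] := pselect (exists B, is_adjoint A B).
  have [bA' AA'] := adj_is_adjoint (ex_intro _ B AB).
  apply: adj_eq; split; first exact: bounded_op_comp.
  by move=> u v; rewrite /= UU' AA'.
rewrite (adj0 noB) adj0//.
move=> [N [bN UAN]]; apply: noB; exists (N \o U); split; first exact: bounded_op_comp.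
by move=> u v; rewrite /= -UAN /= UU' UK.
Qed.

(** [U] matches the Hilbert bases of [E] with those of [F], so the two sets of candidate values
    coincide, even when they are empty. *)
Lemma Tr_unitary E F (X : F -> F) (U : E -> F) U' : unitary_pair U U' ->
  Tr (U' \o X \o U) = Tr X.
Proof.
move=> UP; have [bU bU' UK U'K UU'] := UP.
rewrite /Tr; congr xget; apply/seteqP; split=> t /= Ht e eB.
  have := Ht _ (unitary_basis (unitary_pairC UP) eB).
  congr csum_to; apply/funext => n /=.
  by rewrite U'K (unitary_isometry (unitary_pairC UP)).
have := Ht _ (unitary_basis UP eB).
by congr csum_to; apply/funext => n /=; have [_ _ _ _ ->] := unitary_pairC UP.
Qed.

Lemma hilbert_schmidt_unitary_l E F G (A : E -> F) (U : F -> G) U' : unitary_pair U U' ->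
  hilbert_schmidt A -> hilbert_schmidt (U \o A).
Proof.
move=> UP [bA [e eB Acvg]]; split; first by apply: bounded_op_comp => //; case: UP.
exists e => //; rewrite (_ : (fun n => _) = (fun n => hnorm (A (e n)) ^+ 2))//.
by apply/funext => n; rewrite /= (unitary_hnorm UP).
Qed.

Lemma hilbert_schmidt_unitary_r E F G (A : F -> G) (U : E -> F) U' : unitary_pair U U' ->
  hilbert_schmidt A -> hilbert_schmidt (A \o U).
Proof.
move=> UP [bA [e eB Acvg]]; have [bU _ _ U'K _] := UP.
split; first exact: bounded_op_comp.
exists (U' \o e); first exact: unitary_basis (unitary_pairC UP) eB.
rewrite (_ : (fun n => _) = (fun n => hnorm (A (e n)) ^+ 2))//.
by apply/funext => n; rewrite /= U'K.
Qed.

Lemma hilbert_schmidt0 E F (e : nat -> E) : hilbert_basis e ->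
  hilbert_schmidt ((fun=> 0) : E -> F).
Proof.
move=> eB; split; first exact: bounded_op0.
exists e => //; apply: (nneg_series_cvg (C := 0)) => n; first exact: sqr_ge0.
by rewrite big1// => i _; rewrite /= hnorm0 expr0n.
Qed.

Lemma trace_class_basis E F (A : E -> F) : trace_class A -> exists e : nat -> E, hilbert_basis e.
Proof. by move=> [_ [e eB _]]; exists e. Qed.

Lemma trace_classD E F (A B : E -> F) : hcomplete E ->
  trace_class A -> trace_class B -> trace_class (A \+ B).
Proof.
move=> cE tA tB; have [e eB] := trace_class_basis tA.
apply: (nuclear_trace_class cE eB).
  by apply: bounded_opD; [case: tA|case: tB].
exact: nuclearD (trace_class_nuclear cE tA) (trace_class_nuclear cE tB).
Qed.

Lemma trace_class_unitary_r E F G (A : F -> G) (U : E -> F) U' : hcomplete E -> hcomplete F ->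
  unitary_pair U U' -> trace_class A -> trace_class (A \o U).
Proof.
move=> cE cF UP tA; have [e eB] := trace_class_basis tA.
have [bU _ _ _ _] := UP.
apply: (nuclear_trace_class cE (unitary_basis (unitary_pairC UP) eB)).
  by apply: bounded_op_comp => //; case: tA.
exact: nuclear_contraction_r (unitary_contraction UP) (trace_class_nuclear cF tA).
Qed.

Lemma trace_class_unitary_l E F G (A : E -> F) (U : F -> G) U' : hcomplete E ->
  unitary_pair U U' -> trace_class A -> trace_class (U \o A).
Proof.
move=> cE UP tA; have [e eB] := trace_class_basis tA.
have [bU _ _ _ _] := UP.
apply: (nuclear_trace_class cE eB).
  by apply: bounded_op_comp => //; case: tA.
exact: nuclear_contraction_l (unitary_contraction UP) (trace_class_nuclear cE tA).
Qed.

Lemma trace_classN E F (A : E -> F) : hcomplete E -> trace_class A -> trace_class (fun u => - A u).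
Proof.
move=> cE tA; have UP : unitary_pair (fun u : F => - u) (fun u : F => - u).
  have bN : bounded_op (fun u : F => - u) := bounded_opN (bounded_op_id F).
  split=> //; try exact: opprK.
  by move=> u v; rewrite -(scaleN1r u) -(scaleN1r v) hermZl hermZr rmorphN1.
exact: trace_class_unitary_l cE UP tA.
Qed.

(** Because u' - 1 = - u' (u - 1). *)
Lemma trace_class_adj_unitary E (u u' : E -> E) : hcomplete E -> unitary_pair u u' ->
  trace_class (u \- idfun) -> trace_class (u' \- idfun).
Proof.
move=> cE UP tu; have [bu bu' uK u'K _] := UP; have [linu' _] := bu'.
have := trace_classN cE (trace_class_unitary_l cE (unitary_pairC UP) tu).
congr trace_class; apply/funext => x /=.
by rewrite opB// uK opprB.
Qed.

End UnitaryPairs.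

(** * The eigenspaces of J and their conjugation *)

Section Eigenspaces.
Variables (R : realType) (V : realHilbertType R) (J : {linear V -> V}).
Hypothesis J_square : forall v, J (J v) = - v.
Hypothesis J_isometric : forall u v, inner (J u) (J v) = inner u v.

Lemma hnorm_cplx (u : cplx V) : hnorm u ^+ 2 = `|u.1| ^+ 2 + `|u.2| ^+ 2.
Proof. by rewrite hnorm_sqr -!inner_norm. Qed.

Lemma normr_fst (u : cplx V) : `|u.1| <= hnorm u.
Proof.
by rewrite -(ler_pXn2r (n := 2)) ?nnegrE ?hnorm_ge0// hnorm_cplx lerDl sqr_ge0.
Qed.
Lemma normr_snd (u : cplx V) : `|u.2| <= hnorm u.
Proof.
by rewrite -(ler_pXn2r (n := 2)) ?nnegrE ?hnorm_ge0// hnorm_cplx lerDr sqr_ge0.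
Qed.
Lemma hnorm_cplx_le (u : cplx V) : hnorm u <= `|u.1| + `|u.2|.
Proof.
rewrite -(ler_pXn2r (n := 2)) ?nnegrE ?hnorm_ge0 ?addr_ge0// hnorm_cplx.
by rewrite sqrrD; have := mulr_ge0 (normr_ge0 u.1) (normr_ge0 u.2); lra.
Qed.

Lemma realHilbert_complete (x : nat -> V) :
  (forall e : R, 0 < e -> exists N, forall m n, (N <= n)%N -> (n <= m)%N -> `|x m - x n| <= e) ->
  exists l, forall e : R, 0 < e -> exists N, forall n, (N <= n)%N -> `|x n - l| <= e.
Proof.
move=> xC; have /cauchy_cvg x_cvg : cauchy (x @ \oo).
  apply: cauchy_exP => e e0; have [N xN] := xC _ (divr_gt0 e0 (ltr0Sn _ 1)).
  exists (x N); exists N => // n /= Nn; rewrite -ball_normE /ball_ /=.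
  by rewrite distrC; apply: le_lt_trans (xN _ _ (leqnn N) Nn) _; lra.
exists (lim (x @ \oo)) => e e0; move/cvgrPdist_le : x_cvg => /(_ _ e0)[N _ xN].
by exists N => n Nn; rewrite distrC; exact: xN.
Qed.

Lemma cextJ_isometric (u v : cplx V) : herm (cext J u) (cext J v) = herm u v.
Proof. by congr (_ +i* _); rewrite !J_isometric. Qed.

Lemma J_norm v : `|J v| = `|v|.
Proof.
apply/eqP; rewrite -(eqrXn2 (n := 2))//.
by rewrite -!inner_norm J_isometric.
Qed.

Lemma HplusJ (p : Hplus J) : cext J (val p) = 'i *: (val p : cplx V).
Proof. by apply/eqP; exact: (valP p). Qed.
Lemma HminusJ (m : Hminus J) : cext J (val m) = - 'i *: (val m : cplx V).
Proof. by apply/eqP; exact: (valP m). Qed.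

(** Real and imaginary parts converge in [V], to a and b. Membership in the eigenspace for i means J
    x = - y and J y = x; the first passes to the limit because [J] is isometric, and the second then
    follows from J^2 = -1. *)
Lemma Hplus_complete : hcomplete (Hplus J).
Proof.
move=> x xC.
have [a xa] : exists l, forall e : R, 0 < e ->
    exists N, forall n, (N <= n)%N -> `|(val (x n)).1 - l| <= e.
  apply: realHilbert_complete => e /xC[N xN]; exists N => m n Nn nm.
  exact: le_trans (normr_fst (val (x m - x n))) (xN _ _ Nn nm).
have [b xb] : exists l, forall e : R, 0 < e ->
    exists N, forall n, (N <= n)%N -> `|(val (x n)).2 - l| <= e.
  apply: realHilbert_complete => e /xC[N xN]; exists N => m n Nn nm.
  exact: le_trans (normr_snd (val (x m - x n))) (xN _ _ Nn nm).
have near e : 0 < e -> exists N, forall n, (N <= n)%N ->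
    `|(val (x n)).1 - a| <= e /\ `|(val (x n)).2 - b| <= e.
  move=> e0; have [N1 xN1] := xa _ e0; have [N2 xN2] := xb _ e0.
  exists (maxn N1 N2) => n; rewrite geq_max => /andP[N1n N2n].
  by split; [exact: xN1|exact: xN2].
have Jx n : J (val (x n)).1 = - (val (x n)).2 /\ J (val (x n)).2 = (val (x n)).1.
  have := HplusJ (x n); case: (val (x n)) => y z /= [-> ->] /=.
  by rewrite !scale0r !scale1r !add0r.
have small (v : V) : (forall e : R, 0 < e -> `|v| <= e) -> v = 0.
  move=> ve; apply/eqP; rewrite -normr_le0; apply/ler_addgt0Pr => e e0.
  by rewrite add0r ve.
have Ja : J a = - b.
  apply/eqP; rewrite -addr_eq0; apply/eqP/small => e e0.
  have [N xN] := near _ (divr_gt0 e0 (ltr0Sn _ 1)).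
  have [xaN xbN] := xN N (leqnn N).
  have -> : J a + b = - (J ((val (x N)).1 - a) + ((val (x N)).2 - b)).
    by rewrite linearB (Jx N).1 addrACA addNr add0r -opprD opprK.
  rewrite normrN; apply: le_trans (ler_normD _ _) _; rewrite J_norm; lra.
have Jb : J b = a by rewrite -[b]opprK -Ja linearN J_square opprK.
have ab : ((a, b) : cplx V) \in eigenspace_pred J 'i.
  apply/eqP; congr pair => /=.
    by rewrite Ja scale0r scale1r add0r.
  by rewrite Jb scale0r scale1r add0r.
exists (Eigenvector ab) => e e0; have [N xN] := near _ (divr_gt0 e0 (ltr0Sn _ 1)).
exists N => n /xN[xan xbn].
apply: le_trans (hnorm_cplx_le (val (x n - Eigenvector ab))) _.
by rewrite /=; lra.
Qed.

Definition pm (p : Hplus J) (m : Hminus J) : cplx V := (val p : cplx V) + val m.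

Lemma pm_ex u : exists p m, u = pm p m.
Proof. by exists (eigproj J 'i u), (eigproj J (- 'i) u); rewrite /pm eigprojD. Qed.

Lemma cextJ_pm p m : cext J (pm p m) = pm ('i *: p) (- 'i *: m).
Proof. by rewrite /pm linearD /= HplusJ HminusJ. Qed.

Lemma i_sqr : 'i ^+ 2 = -1 :> R[i]. Proof. exact: sqr_i. Qed.

Lemma double_half (u : cplx V) : 2^-1 *: (u + u) = u.
Proof.
have -> : u + u = (2 : R[i]) *: u by rewrite scaler_nat.
by rewrite scalerA mulVf ?scale1r// pnatr_eq0.
Qed.

Lemma pmZ c p m : c *: pm p m = pm (c *: p) (c *: m).
Proof. by rewrite /pm scalerDr. Qed.
Lemma pmD p m p' m' : pm p m + pm p' m' = pm (p + p') (m + m').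
Proof. by rewrite /pm addrACA. Qed.
Lemma pmB p m p' m' : pm p m - pm p' m' = pm (p - p') (m - m').
Proof. by rewrite /pm opprD addrACA. Qed.

Lemma eigproj_plus p m : eigproj J 'i (pm p m) = p.
Proof.
apply: val_inj; rewrite val_eigproj ?i_sqr// cextJ_pm pmZ !scalerA mulrN -expr2 i_sqr.
rewrite opprK scaleN1r scale1r pmB opprK subrr /pm addr0.
exact: double_half.
Qed.

Lemma eigproj_minus p m : eigproj J (- 'i) (pm p m) = m.
Proof.
apply: val_inj; rewrite val_eigproj ?sqrrN ?i_sqr// cextJ_pm pmZ !scalerA.
rewrite mulrNN mulNr -expr2 i_sqr opprK scaleN1r scale1r pmB opprK subrr /pm add0r.
exact: double_half.
Qed.

Lemma pm_inj p m p' m' : pm p m = pm p' m' -> p = p' /\ m = m'.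
Proof.
move=> E; split; first by rewrite -(eigproj_plus p m) E eigproj_plus.
by rewrite -(eigproj_minus p m) E eigproj_minus.
Qed.

(** [J] preserves the form, while the eigenvalues contribute i times the conjugate of -i, which is
    -1. *)
Lemma herm_Hplus_Hminus (p : Hplus J) (m : Hminus J) : herm (val p : cplx V) (val m) = 0.
Proof.
have := cextJ_isometric (val p) (val m); rewrite HplusJ HminusJ hermZl hermZr mulrA.
rewrite (_ : 'i * _ = -1); last first.
  by apply/eqP; rewrite eq_complex /=; apply/andP; split; apply/eqP; ring.
rewrite mulN1r => /eqP.
by rewrite -subr_eq0 -opprD oppr_eq0 -mulr2n mulrn_eq0 => /eqP.
Qed.

Lemma herm_pm p m p' m' : herm (pm p m) (pm p' m') = herm p p' + herm m m'.
Proof.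
rewrite /pm hermDl !hermDr herm_Hplus_Hminus [herm (val m) (val p')]herm_conj.
by rewrite herm_Hplus_Hminus conjc0 addr0 add0r.
Qed.

Lemma conj_pmD (p q : Hplus J) : conj_pm (p + q) = conj_pm p + conj_pm q.
Proof. by apply: val_inj; congr pair; rewrite /= opprD. Qed.
Lemma conj_mpD (p q : Hminus J) : conj_mp (p + q) = conj_mp p + conj_mp q.
Proof. by apply: val_inj; congr pair; rewrite /= opprD. Qed.
Lemma conj_pmK : cancel (@conj_pm R V J) (@conj_mp R V J).
Proof. by move=> p; apply: val_inj => /=; case: (val p) => x y; rewrite /conjv /= opprK. Qed.
Lemma conj_mpK : cancel (@conj_mp R V J) (@conj_pm R V J).
Proof. by move=> p; apply: val_inj => /=; case: (val p) => x y; rewrite /conjv /= opprK. Qed.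
Lemma conjvZ c (u : cplx V) : conjv (c *: u) = c^* *: conjv u.
Proof.
by case: c u => a b [x y]; congr pair; rewrite /= ?scaleNr ?scalerN ?opprK// opprD.
Qed.
Lemma conj_pmZ c (p : Hplus J) : conj_pm (c *: p) = c^* *: conj_pm p.
Proof. by apply: val_inj; exact: conjvZ. Qed.
Lemma conj_mpZ c (p : Hminus J) : conj_mp (c *: p) = c^* *: conj_mp p.
Proof. by apply: val_inj; exact: conjvZ. Qed.
Lemma herm_conjv (u v : cplx V) : herm (conjv u) (conjv v) = (herm u v)^*.
Proof.
congr (_ +i* _); rewrite /= ?linearN ?linearNl /= ?linearNl ?opprK//.
by rewrite opprD opprK.
Qed.
Lemma herm_conj_pm (p q : Hplus J) : herm (conj_pm p) (conj_pm q) = (herm p q)^*.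
Proof. exact: herm_conjv. Qed.
Lemma herm_conj_mp (p q : Hminus J) : herm (conj_mp p) (conj_mp q) = (herm p q)^*.
Proof. exact: herm_conjv. Qed.

End Eigenspaces.

(** * Block operators and multiplication by block diagonal unitaries *)

Section Blocks.
Variables (R : realType) (V : realHilbertType R) (J : {linear V -> V}).
Hypothesis J_square : forall v, J (J v) = - v.
Hypothesis J_isometric : forall u v, inner (J u) (J v) = inner u v.

Let HP := Hplus J.
Let HM := Hminus J.

Definition conj_op (w : HP -> HP) : HM -> HM := @conj_pm R V J \o w \o @conj_mp R V J.

Definition gl_block (A1 : HP -> HP) (A2 : HM -> HP) : cplx V -> cplx V :=
  block_op A1 A2 (@conj_pm R V J \o A2 \o @conj_pm R V J) (conj_op A1).

Lemma block_opE A11 A12 A21 A22 p m :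
  @block_op R V J A11 A12 A21 A22 (pm p m) = pm (A11 p + A12 m) (A21 p + A22 m).
Proof. by rewrite /block_op eigproj_plus// eigproj_minus. Qed.

Lemma U1_embedE w p m : U1_embed J w (pm p m) = pm (w p) (conj_op w m).
Proof. by rewrite [LHS]block_opE addr0 add0r. Qed.

Lemma gl_blockE A1 A2 p m : gl_block A1 A2 (pm p m) =
  pm (A1 p + A2 m) (conj_pm (A2 (conj_pm p)) + conj_op A1 m).
Proof. exact: block_opE. Qed.

Lemma op_ext (f g : cplx V -> cplx V) : (forall p m, f (@pm R V J p m) = g (pm p m)) -> f = g.
Proof. by move=> fg; apply/funext => u; have [p [m ->]] := pm_ex J_square u. Qed.

Lemma conj_basis (e : nat -> HP) : hilbert_basis e -> hilbert_basis (@conj_pm R V J \o e).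
Proof.
move=> [eON e_tot]; split=> [k l|u ue].
  by rewrite /= herm_conj_pm eON; case: (k == l); rewrite ?conjc1 ?conjc0.
rewrite -[u]conj_mpK (e_tot (conj_mp u)); first by apply: val_inj; rewrite /= /conjv oppr0.
by move=> n; rewrite -[e n]conj_pmK herm_conj_mp [X in X^*]ue conjc0.
Qed.

Lemma hnorm_conj_pm p : hnorm (conj_pm p) = hnorm (p : HP).
Proof. by rewrite /hnorm herm_conj_pm; case: (herm p p). Qed.
Lemma hnorm_conj_mp p : hnorm (conj_mp p) = hnorm (p : HM).
Proof. by rewrite /hnorm herm_conj_mp; case: (herm p p). Qed.

Lemma bounded_conj_op w : bounded_op w -> bounded_op (conj_op w).
Proof.
move=> [linw [C wC]]; split.
  move=> a u v; rewrite /conj_op /= conj_mpD conj_mpZ linw conj_pmD conj_pmZ.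
  by congr (_ *: _ + _); exact: conjcK.
by exists C => u; rewrite /conj_op /= hnorm_conj_pm -[hnorm u]hnorm_conj_mp.
Qed.

Lemma unitary_conj_op w w' : unitary_pair w w' -> unitary_pair (conj_op w) (conj_op w').
Proof.
move=> [bw bw' wK w'K ww']; split; try exact: bounded_conj_op.
- by move=> u; rewrite /conj_op /= conj_pmK wK conj_mpK.
- by move=> u; rewrite /conj_op /= conj_pmK w'K conj_mpK.
move=> u v; rewrite /conj_op /= -[v in LHS]conj_mpK herm_conj_pm ww'.
by rewrite -[u in RHS]conj_mpK herm_conj_pm.
Qed.

Lemma unitary_embed w w' : unitary_pair w w' -> unitary_pair (U1_embed J w) (U1_embed J w').
Proof.
(* The hypothesis is symmetric in the unitary and its inverse, so one half is proved and used
   twice. *)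
suff half v v' : unitary_pair v v' ->
    bounded_op (U1_embed J v) /\ cancel (U1_embed J v) (U1_embed J v').
  move=> UP; have [b K] := half _ _ UP; have [b' K'] := half _ _ (unitary_pairC UP).
  split=> // x y; have [p [m ->]] := pm_ex J_square x; have [q [n ->]] := pm_ex J_square y.
  rewrite !U1_embedE !herm_pm//.
  by have [_ _ _ _ ->] := UP; have [_ _ _ _ ->] := unitary_conj_op UP.
move=> UP; have CP := unitary_conj_op UP.
have [[linv _] _ vK _ _] := UP; have [[lincv _] _ cvK _ _] := CP.
split; last first.
  by move=> x; have [p [m ->]] := pm_ex J_square x; rewrite !U1_embedE vK cvK.
split.
  move=> a x y; have [p [m ->]] := pm_ex J_square x; have [q [n ->]] := pm_ex J_square y.
  by rewrite pmZ pmD !U1_embedE linv lincv pmZ pmD.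
exists 1 => x; have [p [m ->]] := pm_ex J_square x.
rewrite mul1r /hnorm U1_embedE !herm_pm//.
by rewrite (unitary_isometry UP) (unitary_isometry CP).
Qed.

Lemma gl_block_embed_l w A1 A2 : linear w ->
  U1_embed J w \o gl_block A1 A2 = gl_block (w \o A1) (w \o A2).
Proof.
move=> linw; apply: op_ext => p m; rewrite /= !(gl_blockE, U1_embedE) opD//.
by rewrite /conj_op /= conj_mpD !conj_pmK opD// conj_pmD.
Qed.

Lemma gl_block_embed_r w A1 A2 :
  gl_block A1 A2 \o U1_embed J w = gl_block (A1 \o w) (A2 \o conj_op w).
Proof.
apply: op_ext => p m; rewrite /= !(gl_blockE, U1_embedE).
by rewrite /conj_op /= !conj_pmK.
Qed.

Lemma gl_blockD A1 B1 A2 : gl_block A1 (fun=> 0) \+ gl_block B1 A2 = gl_block (A1 \+ B1) A2.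
Proof.
apply: op_ext => p m; rewrite /= !gl_blockE pmD addr0 addrA.
have -> : conj_pm (0 : HP) = 0 by apply: val_inj; rewrite /= /conjv oppr0.
by rewrite /conj_op /= conj_pmD add0r addrCA.
Qed.

Lemma embed_gl_block w : U1_embed J w = idfun \+ gl_block (w \- idfun) (fun=> 0).
Proof.
apply: op_ext => p m; rewrite /= gl_blockE pmD U1_embedE addr0 addrC subrK.
have -> : conj_pm (0 : HP) = 0 by apply: val_inj; rewrite /= /conjv oppr0.
congr pm; rewrite add0r -[m in RHS]conj_mpK -conj_pmD /conj_op /= !conj_pmK.
by rewrite addrC subrK.
Qed.

Lemma gl12P A : gl12 J A -> exists A1 A2,
  [/\ trace_class A1, hilbert_schmidt A2 & A = gl_block A1 A2].
Proof. by []. Qed.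

Lemma gl12I A1 A2 : trace_class A1 -> hilbert_schmidt A2 -> gl12 J (gl_block A1 A2).
Proof. by move=> tA hA; exists A1, A2. Qed.

Section EmbedAction.
Variables w w' : HP -> HP.
Let cH := Hplus_complete J_square J_isometric.
Hypotheses (UP : unitary_pair w w') (tw : trace_class (w \- idfun)).

Lemma gl12_embed_r A : gl12 J A -> gl12 J (A \o U1_embed J w).
Proof.
move=> /gl12P[A1 [A2 [tA hA ->]]]; rewrite gl_block_embed_r; apply: gl12I.
  exact: (trace_class_unitary_r cH cH UP tA).
exact: (hilbert_schmidt_unitary_r (unitary_conj_op UP) hA).
Qed.

Lemma gl12_embed_l A : gl12 J A -> gl12 J (U1_embed J w \o A).
Proof.
have [[linw _] _ _ _ _] := UP.
move=> /gl12P[A1 [A2 [tA hA ->]]]; rewrite (gl_block_embed_l _ _ linw); apply: gl12I.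
  exact: (trace_class_unitary_l cH UP tA).
exact: (hilbert_schmidt_unitary_l UP hA).
Qed.

(** This is where additivity of the trace class is needed. *)
Lemma gl12_add_embed A : gl12 J A -> gl12 J (gl_block (w \- idfun) (fun=> 0) \+ A).
Proof.
move=> /gl12P[A1 [A2 [tA hA ->]]]; have -> := gl_blockD (w \- idfun) A1 A2.
exact: (gl12I (trace_classD cH tw tA) hA).
Qed.

Lemma M12_embed : M12 J (U1_embed J w).
Proof.
exists (gl_block (w \- idfun) (fun=> 0)); last by rewrite embed_gl_block.
(* A basis of H_+ comes with the trace-class hypothesis; its conjugate is the basis of H_- that the
   zero block needs in order to be Hilbert-Schmidt. *)
have [e /conj_basis eB] := trace_class_basis tw.
exact: (gl12I tw (hilbert_schmidt0 _ eB)).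
Qed.

(** With a = 1 + A, the product is a U = 1 + ((U - 1) + A U). *)
Lemma M12_embed_r a : M12 J a -> M12 J (a \o U1_embed J w).
Proof.
move=> [A glA <-]; exists (gl_block (w \- idfun) (fun=> 0) \+ (A \o U1_embed J w)).
  exact/gl12_add_embed/gl12_embed_r.
by apply/funext => x; rewrite /= addrA {2}embed_gl_block.
Qed.

Lemma M12_embed_l a : M12 J a -> M12 J (U1_embed J w \o a).
Proof.
move=> [A glA <-]; exists (gl_block (w \- idfun) (fun=> 0) \+ (U1_embed J w \o A)).
  exact/gl12_add_embed/gl12_embed_l.
have [[linU _] _ _ _ _] := unitary_embed UP.
by apply/funext => x; rewrite /= (opD linU) addrA {2}embed_gl_block.
Qed.
End EmbedAction.

Lemma U1_unitary u : U1 J u -> [/\ unitary_pair u (adj u), trace_class (u \- idfun) &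
  trace_class (adj u \- idfun)].
Proof.
move=> [bu u'u uu' tu]; have cH := Hplus_complete J_square J_isometric.
have [e eB] := trace_class_basis tu; have [bu' uadj] := adjP cH eB bu.
have UP : unitary_pair u (adj u).
  split=> // x; first exact: (congr1 (fun f => f x) u'u).
  exact: (congr1 (fun f => f x) uu').
split; [exact: UP|exact: tu|exact: (trace_class_adj_unitary cH UP tu)].
Qed.

(** The condition on [w'] puts the inverse U^-1 M^-1 in [M12]. *)
Lemma GL12_embed_r w w' M : unitary_pair w w' -> trace_class (w \- idfun) ->
  trace_class (w' \- idfun) -> GL12 J M -> GL12 J (M \o U1_embed J w).
Proof.
move=> UP tw tw' [mM [b [mb Mb bM]]]; have [_ _ UK U'K _] := unitary_embed UP.
split; first exact: (M12_embed_r UP tw mM).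
exists (U1_embed J w' \o b); split; first exact: (M12_embed_l (unitary_pairC UP) tw' mb).
  apply/funext => x /=; rewrite U'K; exact: (congr1 (fun f => f x) Mb).
apply/funext => x /=; rewrite [b _](congr1 (fun f => f (U1_embed J w x)) bM).
exact: UK.
Qed.

End Blocks.

(** * The orthogonal symplectic operators and the zero level set *)

Section Intersection.
Variables (R : realType) (V : realHilbertType R) (J : {linear V -> V}).
Hypothesis J_square : forall v, J (J v) = - v.
Hypothesis J_isometric : forall u v, inner (J u) (J v) = inner u v.

(** [J] is a scalar on each eigenspace, and both diagonal blocks are complex linear. *)
Lemma U1_embed_commJ w : linear w -> U1_embed J w \o cext J = cext J \o U1_embed J w.
Proof.
move=> linw; apply: op_ext => // p m; rewrite /= cextJ_pm !U1_embedE// cextJ_pm opZ//.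
congr pm; rewrite /conj_op /= conj_mpZ opZ// conj_pmZ.
by congr (_ *: _); exact: conjcK.
Qed.

Lemma M12_commJ a : M12 J a -> (forall x, cext J (a x) = a (cext J x)) ->
  exists w, [/\ a = U1_embed J w, bounded_op w & trace_class (w \- idfun)].
Proof.
move=> [_ /gl12P[A1 [A2 [tA hA ->]]] <-] aJ.
have [[linA1 _] _] := tA; have [[linA2 _] _] := hA.
have A20 : A2 = fun=> 0.
  (* On H_- the H_+ component of the commutation reads i A2 m = - i A2 m. *)
  apply/funext => m; have := aJ (pm 0 m).
  rewrite cextJ_pm// scaler0 /= !gl_blockE// !pmD cextJ_pm//.
  move=> /(pm_inj J_square)[+ _]; rewrite op0// !add0r opZ// scaleNr => /eqP.
  rewrite -subr_eq0 opprK -scalerDl scaler_eq0 => /orP[|/eqP //].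
  by rewrite -mulr2n mulrn_eq0 /= eq_complex /= oner_eq0 andbF.
have A1E : (idfun \+ A1) \- idfun = A1 by apply/funext => x; rewrite /= addrAC subrr add0r.
exists (idfun \+ A1); rewrite A1E; split; last exact: tA.
  by rewrite A20 embed_gl_block// A1E.
by apply: bounded_opD; [exact: bounded_op_id|case: tA].
Qed.

Lemma U1_embed_O12_Sp12 u : U1 J u -> (O12 J `&` Sp12 J) (U1_embed J u).
Proof.
move=> /(U1_unitary J_square J_isometric)[UP tu tu'].
have VP := unitary_embed J_square J_isometric UP.
have [_ bU' UK U'K UU'] := VP.
have adjU : adj (U1_embed J u) = U1_embed J (adj u) by apply: adj_eq.
have glU : GL12 J (U1_embed J u).
  split; first exact: (M12_embed J_square tu).
  exists (U1_embed J (adj u)); split; [exact: (M12_embed J_square tu')| |]; exact/funext.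
split; split=> //; rewrite adjU; first exact/funext.
rewrite -compA -U1_embed_commJ; last by case: UP => -[].
by apply/funext => x; rewrite /= UK.
Qed.

Lemma O12_Sp12_U1_embed a : (O12 J `&` Sp12 J) a -> exists2 u, U1 J u & U1_embed J u = a.
Proof.
move=> [[[ma [b [mb ab ba]]] a'a] [_ aJa]].
have abE x : a (b x) = x := congr1 (fun f => f x) ab.
have baE x : b (a x) = x := congr1 (fun f => f x) ba.
have a'E : adj a = b.
  apply/funext => x; rewrite -[x in LHS]abE.
  exact: (congr1 (fun f => f (b x)) a'a).
have aJ x : cext J (a x) = a (cext J x).
  by rewrite -(congr1 (fun f => f x) aJa) /= a'E abE.
have bJ x : cext J (b x) = b (cext J x) by rewrite -[in RHS](abE x) aJ baE.
have ab_adj x y : herm (a x) y = herm x (b y).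
  have [exA|noA] := pselect (exists B, is_adjoint a B).
    by have [_ ->] := adj_is_adjoint exA; rewrite a'E.
  (* Without an adjoint, [adj a] is the default 0, and then [a'a] forces every vector to vanish. *)
  have Z (z : cplx V) : z = 0.
    by apply/esym; have := congr1 (fun f => f z) a'a; rewrite /= (adj0 noA).
  by rewrite (Z (a x)) (Z x) (Z y) (Z (b 0)).
(* The inverse is block diagonal too, and its upper block [v] is the bounded adjoint of [u]. *)
have [u [aE bu tu]] := M12_commJ ma aJ; have [v [bE bv _]] := M12_commJ mb bJ.
have uv p : u (v p) = p.
  by have := abE (pm p 0); rewrite aE bE !U1_embedE// => /(pm_inj J_square)[].
have vu p : v (u p) = p.
  by have := baE (pm p 0); rewrite aE bE !U1_embedE// => /(pm_inj J_square)[].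
have adju : adj u = v.
  apply: adj_eq; split=> // p q; have := ab_adj (pm p 0) (pm q 0).
  rewrite aE bE !U1_embedE// !herm_pm//.
  have h0l x : herm (0 : Hminus J) x = 0 by rewrite -(scale0r 0) hermZl mul0r.
  have h0r x : herm x (0 : Hminus J) = 0 by rewrite herm_conj h0l conjc0.
  by rewrite h0l h0r !addr0.
by exists u => //; split=> //; rewrite adju; exact/funext.
Qed.

Lemma o12_conj w w' A : unitary_pair w w' -> o12 J A ->
  o12 J (U1_embed J w \o A \o U1_embed J w').
Proof.
move=> UP [glA AA]; have VP := unitary_embed J_square J_isometric UP.
have [[linU _] _ _ _ _] := VP.
split.
  apply: gl12_embed_r => //; first exact: unitary_pairC UP.
  exact: gl12_embed_l UP _ glA.
rewrite (adj_unitary_r _ (unitary_pairC VP)) (adj_unitary_l _ VP).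
apply/funext => x; rewrite /= -(opD linU).
by have /= -> := congr1 (fun f => f (U1_embed J w' x)) AA; rewrite (op0 linU).
Qed.

(** As U commutes with [J], the operator (M U)^* J (M U) - J equals U' (M^* J M - J) U. Its product
    with A is the conjugate U' X U of X = (M^* J M - J) U A U', so unitary invariance of the trace
    takes the place of cyclicity. *)
Lemma mu_O_embed_r w w' M A : unitary_pair w w' ->
  mu_O J (M \o U1_embed J w) A = mu_O J M (U1_embed J w \o A \o U1_embed J w').
Proof.
move=> UP; have VP := unitary_embed J_square J_isometric UP.
have [_ [linU' _] UK U'K _] := VP.
rewrite /mu_O (adj_unitary_r _ VP) -[in RHS](Tr_unitary _ VP); congr (_ * Tr _).
apply/funext => x; rewrite /= UK (opB linU'); congr (_ - _).
have [[linw _] _ _ _ _] := UP.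
have UJ : U1_embed J w (cext J (A x)) = cext J (U1_embed J w (A x)).
  exact: (congr1 (fun f => f (A x)) (U1_embed_commJ linw)).
by rewrite -UJ UK.
Qed.

End Intersection.

Theorem proposition3 (R : realType) (V : realHilbertType R)
    (V_separable : exists2 D : set V, countable D & dense D)
    (V_infinite_dim : forall (n : nat) (b : 'I_n -> V), exists v : V,
      forall c : 'I_n -> R, v <> \sum_(i < n) c i *: b i)
    (J : {linear V -> V}) (J_bounded : continuous J)
    (J_square : forall v, J (J v) = - v)
    (J_isometric : forall u v, inner (J u) (J v) = inner u v) :
  [set U1_embed J u | u in U1 J] = O12 J `&` Sp12 J /\
  (forall u M, U1 J u -> mu_O_zero J M -> mu_O_zero J (M \o U1_embed J u)).
Proof.
split.
  apply/seteqP; split=> [_ [u U1u <-]|a]; first exact: U1_embed_O12_Sp12.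
  exact: O12_Sp12_U1_embed.
move=> u M U1u [glM M0]; have [UP tu tu'] := U1_unitary J_square J_isometric U1u.
split; first exact: (GL12_embed_r J_square J_isometric UP tu tu' glM).
move=> A oA; rewrite (mu_O_embed_r J_square J_isometric M A UP).
exact: (M0 _ (o12_conj J_square J_isometric UP oA)).
Qed.
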